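(* Consider the stochastic multiple knapsack problem described in the context. For any constants $d\in\mathbb{N}$, $\epsilon>0$ and $0\le\gamma_i\le1$ ($1\le i\le d$), there is a polynomial time algorithm computing $d$ disjoint subsets $S_1,\dots,S_d\subseteq U$ such that the total profit $\sum_{i=1}^{d}v(S_i)$ is at least $(1-\epsilon)$ times the optimum and $\Pr(w(S_i)\le1+\epsilon)\ge(1-\epsilon)\gamma_i$ for all $1\le i\le d$.
   Context: Stochastic multiple knapsack: a set $U$ of $n$ items and $d$ knapsacks, each of capacity $1$, are given, together with constants $0\le\gamma_i\le1$. Item $j$ has a random nonnegative size $w_j$ (sizes mutually independent, with $\mathbb{E}[\phi^{w_j}]$ computable for complex $|\phi|\le1$) and a deterministic nonnegative integer profit $v_j$. For $S\subseteq U$, $w(S)=\sum_{j\in S}w_j$ and $v(S)=\sum_{j\in S}v_j$. The optimum is the maximum of $\sum_{i=1}^{d}v(S_i)$ over disjoint $S_1,\dots,S_d\subseteq U$ with $\Pr(w(S_i)\le1)\ge\gamma_i$ for all $i$. *)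

(* Defs.v *)
From HB Require Import structures.
From mathcomp Require Import all_boot all_order all_algebra.
From mathcomp Require Import all_classical all_reals all_analysis.
From mathcomp Require Import complex.

Set Implicit Arguments.
Unset Strict Implicit.
Unset Printing Implicit Defensive.

Import Order.TTheory GRing.Theory Num.Theory.
Import numFieldNormedType.Exports.

Local Open Scope ring_scope.

(* The memory is a family of arrays of integers; [s a i] is cell [i] of array
   [a].  Array names are literals of the program, cell indices are computed. *)
Definition store := nat -> int -> int.

Definition upd (s : store) (a : nat) (i z : int) : store :=
  fun b k => if (b == a) && (k == i) then z else s b k.

Inductive binop := Add | Sub | Mul | Div.

Inductive expr :=
| Cst of int
| Get of nat & expr
| Bin of binop & expr & expr.

(* [Query a j x y r m] asks for E[phi ^ w_j] at phi = (x + i y) / r with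
   absolute error 2 ^ - m; the answer is written in cells 0 and 1 of [a]. *)
Inductive com :=
| Skip
| Set_ of nat & expr & expr
| Query of nat & expr & expr & expr & expr & expr
| Seq of com & com
| If of expr & expr & com & com
| While of expr & expr & com.

(* Floor division; division by 0 gives 0. *)
Definition binop_sem (o : binop) (x y : int) : int :=
  match o with
  | Add => x + y
  | Sub => x - y
  | Mul => x * y
  | Div => (x %/ y)%Z
  end.

Fixpoint aeval (s : store) (e : expr) : int :=
  match e with
  | Cst z => z
  | Get a e1 => s a (aeval s e1)
  | Bin o e1 e2 => binop_sem o (aeval s e1) (aeval s e2)
  end.

Definition bitlen (z : int) : nat := (trunc_log 2 `|z|%N).+1.

(* Logarithmic cost: every number that is used, including an address, is
   charged its bit length. *)
Fixpoint acost (s : store) (e : expr) : nat :=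
  match e with
  | Cst z => bitlen z
  | Get a e1 => acost s e1 + bitlen (aeval s (Get a e1))
  | Bin o e1 e2 => acost s e1 + acost s e2 + bitlen (aeval s (Bin o e1 e2))
  end.

Definition oracle := int -> int -> int -> int -> int -> int * int.

(* [exec orc c s s' t]: run with oracle [orc] from memory [s], the program [c]
   halts in memory [s'] after time [t].  The tests of [If] and [While] are
   [e1 <= e2].  A query is charged its arguments, its answer, and the requested
   number of bits (not just the bit length of that number). *)
Inductive exec (orc : oracle) : com -> store -> store -> nat -> Prop :=
| ExSkip s : exec orc Skip s s 1
| ExSet a e1 e2 s :
    exec orc (Set_ a e1 e2) s (upd s a (aeval s e1) (aeval s e2))
      (acost s e1 + acost s e2).+1
| ExQuery a ej ex ey er em s :
    let ans := orc (aeval s ej) (aeval s ex) (aeval s ey) (aeval s er)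
                   (aeval s em) in
    exec orc (Query a ej ex ey er em) s (upd (upd s a 0 ans.1) a 1 ans.2)
      (acost s ej + acost s ex + acost s ey + acost s er + acost s em
       + `|aeval s em|%N + bitlen ans.1 + bitlen ans.2).+1
| ExSeq c1 c2 s s1 s2 t1 t2 :
    exec orc c1 s s1 t1 -> exec orc c2 s1 s2 t2 ->
    exec orc (Seq c1 c2) s s2 (t1 + t2)
| ExIfTrue e1 e2 c1 c2 s s' t :
    aeval s e1 <= aeval s e2 -> exec orc c1 s s' t ->
    exec orc (If e1 e2 c1 c2) s s' (acost s e1 + acost s e2 + t).+1
| ExIfFalse e1 e2 c1 c2 s s' t :
    aeval s e2 < aeval s e1 -> exec orc c2 s s' t ->
    exec orc (If e1 e2 c1 c2) s s' (acost s e1 + acost s e2 + t).+1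
| ExWhileTrue e1 e2 c s s1 s2 t1 t2 :
    aeval s e1 <= aeval s e2 -> exec orc c s s1 t1 ->
    exec orc (While e1 e2 c) s1 s2 t2 ->
    exec orc (While e1 e2 c) s s2 (acost s e1 + acost s e2 + t1 + t2).+1
| ExWhileFalse e1 e2 c s :
    aeval s e2 < aeval s e1 ->
    exec orc (While e1 e2 c) s s (acost s e1 + acost s e2).+1.

(* Hence "there is a halting run such that ..." is a statement about the run. *)
Lemma exec_det orc c s s1 s2 t1 t2 :
  exec orc c s s1 t1 -> exec orc c s s2 t2 -> s1 = s2 /\ t1 = t2.
Proof.
move=> H; elim: H s2 t2 => {c s s1 t1}.
- by move=> s s2 t2 H; inversion H.
- by move=> a e1 e2 s s2 t2 H; inversion H.
- by move=> a ej ex ey er em s ans s2 t2 H; inversion H.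
- move=> c1 c2 s s1 s2 t1 t2 _ IH1 _ IH2 s3 t3 H.
  inversion H as [| | |c1' c2' s' sa sb ta tb Ha Hb| | | |]; subst.
  have [? ?] := IH1 _ _ Ha; subst.
  by have [? ?] := IH2 _ _ Hb; subst.
- move=> e1 e2 c1 c2 s s1 t1 le12 _ IH s2 t2 H.
  inversion H as [| | | |? ? ? ? ? ? t' _ H'|? ? ? ? ? ? t' lt21 H'| |]; subst.
  + by have [? ?] := IH _ _ H'; subst.
  + by rewrite ltNge le12 in lt21.
- move=> e1 e2 c1 c2 s s1 t1 lt21 _ IH s2 t2 H.
  inversion H as [| | | |? ? ? ? ? ? t' le12 H'|? ? ? ? ? ? t' _ H'| |]; subst.
  + by rewrite ltNge le12 in lt21.
  + by have [? ?] := IH _ _ H'; subst.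
- move=> e1 e2 c s s1 s2 t1 t2 le12 _ IH1 _ IH2 s3 t3 H.
  inversion H as [| | | | | |? ? ? ? ? ? ? ? _ Ha Hb|? ? ? ? lt21]; subst.
  + have [? ?] := IH1 _ _ Ha; subst.
    by have [? ?] := IH2 _ _ Hb; subst.
  + by rewrite ltNge le12 in lt21.
- move=> e1 e2 c s lt21 s2 t2 H.
  inversion H as [| | | | | |? ? ? ? ? ? ? ? le12 Ha Hb|]; subst => //.
  by rewrite ltNge le12 in lt21.
Qed.

(* Initially cell 0 of array 0 holds n, array 1 holds the n profits, and all
   other cells hold 0.  The sizes are accessible through the oracle only. *)
Definition input (n : nat) (v : 'I_n -> nat) : store := fun a i =>
  match a, i with
  | 0%N, Posz 0%N => n%:Z
  | 1%N, Posz k => if insub k is Some j then (v j)%:Z else 0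
  | _, _ => 0
  end.

Definition input_size (n : nat) (v : 'I_n -> nat) : nat :=
  (bitlen n%:Z + \sum_(j < n) bitlen (v j)%:Z)%N.

(* Array i + 2 is the indicator of the i-th knapsack. *)
Definition output (d n : nat) (s : store) (i : 'I_d) : {set 'I_n} :=
  [set j : 'I_n | s (nat_of_ord i).+2 (nat_of_ord j)%:Z == 1].
Arguments output d n s i : clear implicits.

Section ComplexPower.
Local Open Scope complex_scope.

Definition principal_arg (R : realType) (phi : R[i]) : R :=
  let theta := acos (complex.Re phi / complex.Re `|phi|) in
  if 0 <= complex.Im phi then theta else - theta.

(* phi ^ x = exp (x Log phi) for x >= 0, with the principal logarithm, and
   0 ^ 0 = 1, 0 ^ x = 0 for x > 0 (this is how powR behaves at 0). *)
Definition cpow (R : realType) (phi : R[i]) (x : R) : R[i] :=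
  let rho := complex.Re `|phi| `^ x in
  (rho * cos (x * principal_arg phi)) +i* (rho * sin (x * principal_arg phi)).

Definition cexpectation d (T : measurableType d) (R : realType)
    (P : probability T R) (X : T -> R[i]) : R[i] :=
  fine 'E_P[fun t => complex.Re (X t)] +i* fine 'E_P[fun t => complex.Im (X t)].

(* [orc] computes E[phi ^ w_j] in the sense of computable analysis: phi ranges
   over the Gaussian rationals of the closed unit disc, and the answer is a
   dyadic approximation within 2 ^ - m.  Nothing is assumed on the answers to
   other queries. *)
Definition computes_expectations d (T : measurableType d) (R : realType)
    (P : probability T R) (n : nat) (w : 'I_n -> {RV P >-> R})
    (orc : oracle) : Prop :=
  forall (j : 'I_n) (x y r : int) (m : nat),
    let phi : R[i] := (x%:~R / r%:~R) +i* (y%:~R / r%:~R) in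
    let ans := orc (nat_of_ord j)%:Z x y r m%:Z in
    0 < r -> `|phi| <= 1 ->
    `|(ans.1%:~R / 2 ^+ m) +i* (ans.2%:~R / 2 ^+ m)
      - cexpectation P (fun t => cpow phi (w j t))| <= (2 ^- m)%:C.

End ComplexPower.

Definition mutually_independent d (T : measurableType d) (R : realType)
    (P : probability T R) (n : nat) (w : 'I_n -> {RV P >-> R}) : Prop :=
  forall (J : {set 'I_n}) (B : 'I_n -> set R),
    (forall j, measurable (B j)) ->
    (P [set t | forall j, j \in J -> B j (w j t)]%classic
     = \prod_(j in J) P [set t | B j (w j t)]%classic)%E.

Definition total_size d (T : measurableType d) (R : realType)
    (P : probability T R) (n : nat) (w : 'I_n -> {RV P >-> R})
    (S : {set 'I_n}) (t : T) : R :=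
  \sum_(j in S) w j t.

Definition profit (n : nat) (v : 'I_n -> nat) (S : {set 'I_n}) : nat :=
  (\sum_(j in S) v j)%N.

Definition total_profit (d n : nat) (v : 'I_n -> nat)
    (S : 'I_d -> {set 'I_n}) : nat :=
  (\sum_(i < d) profit v (S i))%N.

Definition pairwise_disjoint (d n : nat) (S : 'I_d -> {set 'I_n}) : bool :=
  [forall i : 'I_d, forall j : 'I_d, (i != j) ==> [disjoint S i & S j]].

Definition fits d (T : measurableType d) (R : realType)
    (P : probability T R) (n : nat) (w : 'I_n -> {RV P >-> R})
    (cap p : R) (S : {set 'I_n}) : bool :=
  (p%:E <= P [set t | (total_size w S t <= cap)%R]%classic)%E.

(* The maximum is over a nonempty set: the empty subsets are feasible for
   nonnegative sizes and gamma <= 1. *)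
Definition opt disp (T : measurableType disp) (R : realType)
    (P : probability T R) (d n : nat) (w : 'I_n -> {RV P >-> R})
    (v : 'I_n -> nat) (gamma : 'I_d -> R) : nat :=
  (\max_(S : {ffun 'I_d -> {set 'I_n}} |
     pairwise_disjoint S && [forall i, fits w 1%R (gamma i) (S i)])
     total_profit v S)%N.

(* Main.v *)
Require Import Defs.
From HB Require Import structures.
From mathcomp Require Import all_boot all_order all_algebra.
From mathcomp Require Import all_classical all_reals all_analysis.
From mathcomp Require Import measurable_realfun complex zify ring lra.

Set Implicit Arguments.
Unset Strict Implicit.
Unset Printing Implicit Defensive.

Import Order.TTheory GRing.Theory Num.Theory.
Local Open Scope ring_scope.

(* Let M = b q and f(y) = 1 - (1 - y)^M.  By Bernoulli's inequality f(q^-x) is at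
   least 1 - 1/b for x in [0, 1] and, when q^-eps <= 1/b^2, at most 1/b for
   x >= 1 + eps; so E[f(q^-w(S))] >= gamma is the chance constraint up to O(1/b).
   Expanding f, this mean is a fixed integer combination of the products over
   j in S of E[(q^-k)^w_j], 1 <= k <= M, which are numbers in [0, 1] returned by
   the oracle.  A dynamic program keeps the d M products rounded to multiples of
   1/r, where r is linear in n: an item adds at most 3/r to the error, the number
   of states r^O(1) is polynomial, and the best profit of each state is exact. *)

(** * Means of bounded functions and independence *)

(** The program must be fixed before [n] and the instance are known. Therefore [b], [q], [M], the
    coefficients of f and the integer thresholds, which depend on [eps] and [gamma] alone, are
    literals of its text; the reals [gamma i] enter only through [Num.floor]. The obstacle is that
    the probability of w(S) <= 1 is not determined by a few numbers that can be updated item by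
    item, whereas the products of moments are. Their combination has coefficients of absolute sum at
    most 2^M, a constant, so a resolution linear in [n] survives it; and since all factors lie in
    [0, 1], rounding errors add up along the items without being amplified. The error budget, in
    units of 1/b, is: 1 for replacing the indicator by f, 1 for the computation, 2 for shifting the
    threshold so that no feasible solution is lost, 1 for its integer part. This makes 5 for an
    accepted state, whence 1/b <= eps gamma_i / 5 for the positive gamma_i; for gamma_i = 0 the
    constraint is void. *)

Section Mean.
Context {disp : measure_display} {T : measurableType disp} {R : realType}.
Variable P : probability T R.

Definition mean (f : T -> R) : R := Rintegral P setT f.

(** Bounded measurable functions are closed under sums and products and integrable for a
    probability, so no integrability condition has to be carried along. *)
Definition tame (f : T -> R) : Prop :=
  measurable_fun setT f /\ exists K : R, forall t, `|f t| <= K.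

Lemma tame_integrable f : tame f -> P.-integrable setT (EFin \o f).
Proof.
move=> [mf [K hK]]; apply: measurable_bounded_integrable => //.
  by apply: fin_num_fun_lty; exact: fin_num_measure.
by exists K; split=> [|x Kx t _]; [exact: num_real|exact: le_trans (ltW Kx)].
Qed.

Lemma tame_cst c : tame (fun=> c).
Proof. by split; [exact: measurable_cst|exists `|c|]. Qed.

Lemma tameD f g : tame f -> tame g -> tame (fun t => f t + g t).
Proof.
move=> [mf [K hK]] [mg [L hL]]; split; first exact: measurable_funD.
by exists (K + L) => t; apply: le_trans (ler_normD _ _) (lerD _ _).
Qed.

Lemma tameM f g : tame f -> tame g -> tame (fun t => f t * g t).
Proof.
move=> [mf [K hK]] [mg [L hL]]; split; first exact: measurable_funM.
by exists (K * L) => t; rewrite normrM ler_pM.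
Qed.

Lemma tameZ c f : tame f -> tame (fun t => c * f t).
Proof. by move=> tf; apply: tameM => //; exact: tame_cst. Qed.

Lemma tame_sum (I : Type) (s : seq I) (Q : pred I) (f : I -> T -> R) :
  (forall i, tame (f i)) -> tame (fun t => \sum_(i <- s | Q i) f i t).
Proof.
move=> tf; elim: s => [|i s IH].
  by rewrite [X in tame X](_ : _ = fun=> 0); [exact: tame_cst|
    apply/funext => t; rewrite big_nil].
rewrite [X in tame X](_ : _ = fun t => (if Q i then f i t else 0) +
    \sum_(i <- s | Q i) f i t); last first.
  by apply/funext => t; rewrite big_cons; case: ifP; rewrite ?add0r.
by apply: tameD => //; case: (Q i); [exact: tf|exact: tame_cst].
Qed.

Lemma tame_prod (I : Type) (s : seq I) (Q : pred I) (f : I -> T -> R) :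
  (forall i, tame (f i)) -> tame (fun t => \prod_(i <- s | Q i) f i t).
Proof.
move=> tf; elim: s => [|i s IH].
  by rewrite [X in tame X](_ : _ = fun=> 1); [exact: tame_cst|
    apply/funext => t; rewrite big_nil].
rewrite [X in tame X](_ : _ = fun t => (if Q i then f i t else 1) *
    \prod_(i <- s | Q i) f i t); last first.
  by apply/funext => t; rewrite big_cons; case: ifP; rewrite ?mul1r.
by apply: tameM => //; case: (Q i); [exact: tf|exact: tame_cst].
Qed.

Lemma tame_indic (A : set T) : measurable A -> tame (\1_A : T -> R).
Proof.
move=> mA; split; first exact: measurable_indic.
by exists 1 => t; rewrite indicE; case: (_ \in _); rewrite ?normr1 ?normr0.
Qed.

Lemma mean_cst c : mean (fun=> c) = c.
Proof.
rewrite /mean Rintegral_cst// -[RHS]mulr1.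
exact: (congr1 (fun z => c * fine z) (probability_setT P)).
Qed.

Lemma meanD f g : tame f -> tame g ->
  mean (fun t => f t + g t) = mean f + mean g.
Proof. by move=> /tame_integrable ? /tame_integrable ?; exact: RintegralD. Qed.

Lemma meanZ c f : tame f -> mean (fun t => c * f t) = c * mean f.
Proof. by move=> /tame_integrable ?; exact: RintegralZl. Qed.

Lemma mean_sum (I : Type) (s : seq I) (f : I -> T -> R) :
  (forall i, tame (f i)) ->
  mean (fun t => \sum_(i <- s) f i t) = \sum_(i <- s) mean (f i).
Proof.
move=> tf; elim: s => [|i s IH].
  by rewrite big_nil -[RHS]mean_cst; congr mean; apply/funext => t; rewrite big_nil.
rewrite big_cons -IH -meanD//; last exact: tame_sum.
by congr mean; apply/funext => t; rewrite big_cons.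
Qed.

Lemma le_mean f g : tame f -> tame g -> (forall t, f t <= g t) ->
  mean f <= mean g.
Proof. by move=> /tame_integrable ? /tame_integrable ? fg; exact: le_Rintegral. Qed.

Lemma mean01 f : tame f -> (forall t, 0 <= f t <= 1) -> 0 <= mean f <= 1.
Proof.
move=> tf f01; rewrite -[X in _ <= _ <= X]mean_cst -[X in X <= _]mean_cst.
by rewrite !le_mean//; try exact: tame_cst; move=> t; have /andP[] := f01 t.
Qed.

Lemma mean_dist f g c : tame f -> tame g -> (forall t, `|f t - g t| <= c) ->
  `|mean f - mean g| <= c.
Proof.
move=> tf tg fg; have tcg : tame (fun t => c + g t) by apply: tameD => //; exact: tame_cst.
have tcf : tame (fun t => c + f t) by apply: tameD => //; exact: tame_cst.
rewrite ler_distl lerBlDl; apply/andP; split; rewrite -[c]mean_cst -?meanD//.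
all: try exact: tame_cst.
- by apply: le_mean => // t; have := fg t; rewrite ler_distl => /andP[]; rewrite lerBlDl.
- by apply: le_mean => //; [apply: tameD => //; exact: tame_cst|] => t;
    have := fg t; rewrite ler_distl => /andP[].
Qed.

Lemma mean_indic (A : set T) : measurable A -> mean \1_A = fine (P A).
Proof. by move=> mA; rewrite /mean /Rintegral integral_indic// setIT. Qed.

Lemma expectationE f : fine 'E_P[f] = mean f.
Proof. by rewrite unlock. Qed.

(** The sum counts the [i < m] with [i + 1 <= m x], so it is the integer part of [m x]. *)
Lemma step_approx (m : nat) (x : R) : (0 < m)%N -> 0 <= x <= 1 ->
  `|m%:R * x - \sum_(i < m) \1_[set y | i.+1%:R <= m%:R * y] x| <= 1.
Proof.
move=> m0 /andP[x0 x1]; set y := m%:R * x.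
have y0 : 0 <= y by rewrite mulr_ge0.
have ym : y <= m%:R by rewrite ler_piMr.
have /andP[ky yk] := truncn_itv y0; set k := Num.truncn y in ky yk.
have km : (k <= m)%N by rewrite -(ler_nat R); apply: le_trans ym.
have -> : \sum_(i < m) \1_[set y | i.+1%:R <= m%:R * y] x = k%:R :> R.
  rewrite (eq_bigr (fun i : 'I_m => (i < k)%N%:R)) => [|i _]; last first.
    by rewrite indicE truncn_gt_nat; congr (nat_of_bool _)%:R; apply/idP/idP; rewrite inE.
  rewrite -(big_mkord xpredT (fun i => (i < k)%N%:R)) (big_cat_nat _ km)//=.
  rewrite [X in _ + X](eq_big_nat _ _ (F2 := fun=> 0)); last first.
    by move=> i /andP[ki _]; rewrite ltnNge ki.
  rewrite sumr_const_nat mul0rn addr0 (eq_big_nat _ _ (F2 := fun=> 1)).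
    by rewrite sumr_const_nat subn0.
  by move=> i /andP[_ ->].
by rewrite ger0_norm; rewrite ?subr_ge0// lerBlDl natr1 ltW.
Qed.

(* [m X] is within 1 of the sum of the indicators of [i + 1 <= m X], [i < m]. *)
Lemma mean_mul_layers (X F : T -> R) (c : R) :
  measurable_fun setT X -> (forall t, 0 <= X t <= 1) ->
  tame F -> (forall t, 0 <= F t <= 1) -> 0 <= c <= 1 ->
  (forall B : set R, measurable B ->
     mean (fun t => \1_B (X t) * F t) = mean (fun t => \1_B (X t)) * c) ->
  mean (fun t => X t * F t) = mean X * c.
Proof.
move=> mX X01 tF F01 c01 h.
have tX : tame X.
  by split=> //; exists 1 => t; have /andP[? ?] := X01 t; rewrite ger0_norm.
have tXF : tame (fun t => X t * F t) by exact: tameM.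
apply/eqP; rewrite -subr_eq0 -normr_le0.
apply/ler_addgt0Pr => e e0; rewrite add0r.
(* After multiplication by [m] the allowed error is at least 2, which pays for the two
   discretization errors [d1] and [d2] of at most 1 each. *)
pose m := (Num.truncn (2 / e)).+1.
have me : 2 <= m%:R * e.
  by rewrite -ler_pdivrMr//; apply/ltW/truncnS_gt.
have m0 : 0 < m%:R :> R by rewrite ltr0n.
rewrite -(ler_pM2l m0); apply: le_trans me.
pose B (i : nat) := [set y : R | i.+1%:R <= m%:R * y]%classic.
have mB i : measurable (B i).
  rewrite (_ : B i = ((fun y => m%:R * y) @^-1` `[i.+1%:R, +oo[)%classic).
    rewrite -[X in measurable X]setTI.
    by apply: (measurable_funM (f := cst m%:R)).
  by apply/seteqP; split=> y /=; rewrite in_itv/= andbT.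
have tB i : tame (fun t => \1_(B i) (X t)).
  rewrite [X in tame X](_ : _ = \1_((X @^-1` B i)%classic)); last first.
    by apply/funext => t; rewrite !indicE.
  by apply: tame_indic; rewrite -[X in measurable X]setTI; exact: mX.
pose H (t : T) : R := \sum_(i < m) \1_(B i) (X t).
have tH : tame H by apply: tame_sum => i; exact: tB.
have eqH : mean (fun t => H t * F t) = mean H * c.
  rewrite /H [in RHS]mean_sum// mulr_suml.
  rewrite (_ : (fun t => _ * _) = fun t => \sum_(i < m) (\1_(B i) (X t) * F t)).
    rewrite mean_sum; first by apply: eq_bigr => i _; exact: h.
    by move=> i; exact: tameM.
  by apply/funext => t; rewrite mulr_suml.
have HX t : `|m%:R * X t - H t| <= 1 by exact: step_approx.
have d1 : `|mean (fun t => m%:R * (X t * F t)) - mean (fun t => H t * F t)| <= 1.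
  apply: mean_dist; [exact: tameZ|exact: tameM|].
  move=> t; rewrite mulrA -mulrBl normrM; have /andP[F0 F1] := F01 t.
  by rewrite (ger0_norm F0); apply: le_trans (HX t); rewrite ler_piMr.
have d2 : `|mean (fun t => m%:R * X t) - mean H| <= 1.
  by apply: mean_dist => //; exact: tameZ.
rewrite -(gtr0_norm m0) -normrM mulrBr -meanZ// mulrA -(@meanZ _ X)//.
rewrite -(subrKA (mean H * c)) -{1}eqH -mulrBl.
apply: le_trans (ler_normD _ _) _; rewrite -[2]/(1 + 1) lerD//.
have /andP[c0 c1] := c01.
rewrite normrM (ger0_norm c0) distrC; apply: le_trans d2.
by rewrite ler_piMr.
Qed.

End Mean.

(** * Means of products of functions of independent variables *)

Section Independence.
Context {disp : measure_display} {T : measurableType disp} {R : realType}.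
Variables (P : probability T R) (n : nat) (w : 'I_n -> {RV P >-> R}).
Hypothesis w_indep : mutually_independent w.

(** Independence is applied to the full index set; a proper subset of the items is treated in
    [mean_soft] by giving the other items the constant factor 1. *)
Lemma mean_prod_indic (B : 'I_n -> set R) : (forall j, measurable (B j)) ->
  mean P (fun t => \prod_j \1_(B j) (w j t)) =
  \prod_j mean P (fun t => \1_(B j) (w j t)).
Proof.
move=> mB; have mw j : measurable [set t | B j (w j t)]%classic.
  by rewrite -[X in measurable X]setTI; apply: (measurable_funP (w j)).
have wE j : (fun t => \1_(B j) (w j t)) = \1_([set t | B j (w j t)]%classic) :> (T -> R).
  by apply/funext => t; rewrite !indicE.
set A := [set t | forall j, j \in [set: 'I_n]%SET -> B j (w j t)]%classic.
have AE : A = (\bigcap_(j in [set: 'I_n]%classic) [set t | B j (w j t)])%classic.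
  by apply/seteqP; split=> t At j _; apply: At; rewrite ?inE.
have mA : measurable A.
  rewrite AE; apply: fin_bigcap_measurable => // j _; exact: mw.
rewrite (_ : (fun t => _) = \1_A); last first.
  apply/funext => t; rewrite indicE; have [At|At] := boolP (t \in A).
    rewrite big1// => j _; rewrite indicE mem_set//.
    by move: At; rewrite inE => /(_ j); rewrite inE; exact.
  have [j nB] : exists j, ~ B j (w j t).
    apply/not_existsP => h; move/negP: At; apply; rewrite inE => j _.
    exact: contrapT (h j).
  by rewrite (bigD1 j)//= indicE memNset// mul0r.
rewrite mean_indic//; apply: etrans (congr1 fine (w_indep [set: 'I_n] mB)) _.
rewrite [in LHS](eq_bigl xpredT) => [|j]; last exact: finset.in_setT.
rewrite (eq_bigr (fun j => (mean P (fun t => \1_(B j) (w j t)))%:E)).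
  by rewrite -(big_morph EFin EFinM erefl).
by move=> j _; rewrite wE mean_indic// fineK// fin_num_measure.
Qed.

Lemma mean_prod_independent (Y : 'I_n -> R -> R) :
  (forall j, measurable_fun setT (Y j)) ->
  (forall j t, 0 <= Y j (w j t) <= 1) ->
  mean P (fun t => \prod_j Y j (w j t)) = \prod_j mean P (fun t => Y j (w j t)).
Proof.
(* Induction on the number [k] of factors that are not indicators. *)
suff gen k (Z : 'I_n -> R -> R) : (forall j, measurable_fun setT (Z j)) ->
    (forall j t, 0 <= Z j (w j t) <= 1) ->
    (forall j : 'I_n, (k <= j)%N -> exists2 B, measurable B & Z j = \1_B) ->
    mean P (fun t => \prod_j Z j (w j t)) = \prod_j mean P (fun t => Z j (w j t)).
  by move=> mY Y01; apply: (gen n) => // j; rewrite leqNgt ltn_ord.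
elim: k Z => [|k IH] Z mZ Z01 hZ.
  have /choice[B hB] : forall j, exists B, measurable B /\ Z j = \1_B.
    by move=> j; have [B ? ?] := hZ j isT; exists B.
  rewrite (_ : Z = fun j => \1_(B j)); last by apply/funext => j; have [] := hB j.
  by apply: mean_prod_indic => j; have [] := hB j.
have [kn|nk] := ltnP k n; last first.
  by apply: IH => // j kj; have := ltn_ord j; lia.
have mZw j : measurable_fun setT (fun t => Z j (w j t)).
  by apply: measurableT_comp => //; exact: measurable_funP.
have tZ j : tame (fun t => Z j (w j t)).
  by split=> //; exists 1 => t; have /andP[? ?] := Z01 j t; rewrite ger0_norm.
pose k0 := Ordinal kn.
rewrite (bigD1 k0)//=.
rewrite (_ : (fun t => \prod_j _) =
    fun t => Z k0 (w k0 t) * \prod_(j | j != k0) Z j (w j t)); last first.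
  by apply/funext => t; rewrite (bigD1 k0).
apply: mean_mul_layers => //.
- exact: tame_prod.
- move=> t; apply/andP; split.
    by apply: prodr_ge0 => j _; have /andP[] := Z01 j t.
  exact: prodr_ile1.
- apply/andP; split.
    by apply: prodr_ge0 => j _; have /andP[] := mean01 P (tZ j) (Z01 j).
  by apply: prodr_ile1 => j _; exact: mean01.
(* [Z'] replaces factor [k0] by an indicator, so the induction hypothesis applies to it and gives
   exactly the factorization over events that [mean_mul_layers] asks for. *)
- move=> B mB; pose Z' j := if j == k0 then \1_B \o Z k0 else Z j.
  have mB' : measurable (Z k0 @^-1` B)%classic.
    by rewrite -[X in measurable X]setTI; exact: mZ.
  have Z'k0 : Z' k0 = \1_((Z k0 @^-1` B)%classic).
    by apply/funext => x; rewrite /Z' eqxx/= !indicE.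
  have Z'E j : j != k0 -> Z' j = Z j by rewrite /Z' => /negbTE ->.
  have : mean P (fun t => \prod_j Z' j (w j t)) =
      \prod_j mean P (fun t => Z' j (w j t)).
    apply: IH.
    + move=> j; have [->|/Z'E ->//] := eqVneq j k0.
      by rewrite Z'k0; exact: measurable_indic.
    + move=> j t; have [->|/Z'E ->//] := eqVneq j k0.
      by rewrite Z'k0 indicE; case: (_ \in _); rewrite ?lexx ler01.
    + move=> j kj; have [->|jk] := eqVneq j k0; first by exists (Z k0 @^-1` B)%classic.
      rewrite Z'E//; apply: hZ; rewrite ltn_neqAle kj andbT.
      by apply: contra jk => /eqP e; apply/eqP/val_inj.
  rewrite (bigD1 k0)//= (_ : (fun t => \prod_j _) =
      fun t => \1_B (Z k0 (w k0 t)) * \prod_(j | j != k0) Z j (w j t)).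
    move=> ->; congr (_ * _).
      by rewrite Z'k0; congr mean; apply/funext => t; rewrite !indicE.
    by apply: eq_bigr => j jk; rewrite Z'E.
  apply/funext => t; rewrite (bigD1 k0)//= {1}/Z' eqxx/=; congr (_ * _).
  by apply: eq_bigr => j jk; rewrite Z'E.
Qed.

End Independence.

(** * The soft step function *)

Section SoftStep.
Variable R : realType.

Definition soft (M : nat) (y : R) : R := 1 - (1 - y) ^+ M.

(** Coefficient of y^(k+1) in the binomial expansion of 1 - (1 - y)^M, whose constant term
    cancels. *)
Definition soft_coef (M k : nat) : int := (-1) ^+ k *+ 'C(M, k.+1).

Lemma soft_expand M y :
  soft M y = \sum_(k < M) (soft_coef M k)%:~R * y ^+ k.+1.
Proof.
rewrite /soft exprBn big_ord_recl/= subn0 !expr0 !expr1n bin0 !mulr1 opprD addNKr.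
rewrite -sumrN; apply: eq_bigr => i _.
rewrite /bump/= add1n expr1n mulr1 /soft_coef rmorphMn rmorphXn/= rmorphN1.
by rewrite exprS mulN1r mulNr mulNrn opprK mulrnAl.
Qed.

Lemma soft_coef_sum M : \sum_(k < M) `|(soft_coef M k)%:~R : R| <= (2 ^ M)%:R.
Proof.
have -> : \sum_(k < M) `|(soft_coef M k)%:~R : R| = (\sum_(k < M) 'C(M, k.+1))%:R.
  rewrite natr_sum; apply: eq_bigr => k _.
  by rewrite /soft_coef rmorphMn rmorphXn/= rmorphN1 normrMn normrX normrN1 expr1n.
rewrite ler_nat -[2%N]/(1 + 1)%N expnDn big_ord_recl/=.
rewrite [X in (_ + X)%N](eq_bigr (fun k : 'I_M => 'C(M, k.+1))) ?leq_addl// => k _.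
by rewrite !exp1n !muln1.
Qed.

Lemma bernoulli_ineq (x : R) k : -1 <= x -> 1 + k%:R * x <= (1 + x) ^+ k.
Proof.
move=> x1; elim: k => [|k IH]; first by rewrite mul0r addr0 expr0.
rewrite exprS; have x0 : 0 <= 1 + x by lra.
apply: le_trans (ler_wpM2l x0 IH); rewrite -natr1.
have : 0 <= k%:R * x ^+ 2 by rewrite mulr_ge0// sqr_ge0.
lra.
Qed.

Lemma soft01 M y : 0 <= y <= 1 -> 0 <= soft M y <= 1.
Proof.
move=> /andP[y0 y1]; have h0 : 0 <= 1 - y by lra.
have := exprn_ge0 M h0; have : (1 - y) ^+ M <= 1 by rewrite exprn_ile1//; lra.
by rewrite /soft; lra.
Qed.

Variables (q b : nat).
Hypotheses (q1 : (0 < q)%N) (b0 : (0 < b)%N).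

Lemma base01 : 0 < (q%:R^-1 : R) <= 1.
Proof. by rewrite invr_gt0 ltr0n q1/= invf_le1 ?ltr0n// ler1n. Qed.

Lemma power01 x : 0 <= x -> 0 <= (q%:R^-1 : R) `^ x <= 1.
Proof.
move=> x0; rewrite powR_ge0/= -[X in _ <= X](powRr0 (q%:R^-1)).
exact: (ger_powR base01).
Qed.

(** With u = 1/q and M u = b, Bernoulli gives (1 + u)^M >= 1 + b, while (1 - u)^M (1 + u)^M <= 1.
    Hence (1 - u)^M <= 1/b, and u^x >= u for x <= 1. *)
Lemma soft_lower x : x <= 1 -> 0 <= x ->
  1 - b%:R^-1 <= soft (b * q) (q%:R^-1 `^ x).
Proof.
move=> x1 x0; have /andP[u0 u1] := base01; set u := q%:R^-1 in u0 u1 *.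
have uy : u <= u `^ x.
  by rewrite -[X in X <= _](powRr1 (ltW u0)); apply: (ger_powR base01).
have /andP[y0 y1] := power01 x0; rewrite -/u in y0 y1.
have bR : 0 < b%:R :> R by rewrite ltr0n.
rewrite /soft lerD2l lerN2.
apply: (@le_trans _ _ ((1 - u) ^+ (b * q))).
  by apply: lerXn2r; rewrite ?nnegrE; lra.
have h1 : 1 + b%:R <= (1 + u) ^+ (b * q).
  apply: le_trans (bernoulli_ineq _ _); last lra.
  by rewrite natrM -mulrA mulfV ?mulr1// pnatr_eq0; lia.
have h2 : (1 - u) ^+ (b * q) * (1 + u) ^+ (b * q) <= 1.
  rewrite -exprMn exprn_ile1//; nra.
have h3 : 0 <= (1 - u) ^+ (b * q) by rewrite exprn_ge0//; lra.
rewrite -(ler_pM2r bR) mulVf ?gt_eqF//; apply: le_trans h2.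
by apply: ler_wpM2l => //; lra.
Qed.

(** Bernoulli at -u^x bounds the soft step by M u^x <= b q u u^eps = b u^eps; the square in the
    hypothesis on [q] makes this at most 1/b. *)
Lemma soft_upper (eps x : R) : 0 < eps ->
  q%:R^-1 `^ eps <= (b%:R ^+ 2)^-1 -> 1 + eps <= x ->
  soft (b * q) (q%:R^-1 `^ x) <= b%:R^-1.
Proof.
move=> eps0; have /andP[u0 u1] := base01; set u := q%:R^-1 in u0 u1 *.
move=> ue ex; have bR : 0 < b%:R :> R by rewrite ltr0n.
have yle : u `^ x <= u * u `^ eps.
  rewrite -[X in X * _](powRr1 (ltW u0)) -powRD; last first.
    by apply/implyP => _; rewrite gt_eqF.
  exact: (ger_powR base01).
have /andP[y0 y1] : 0 <= u `^ x <= 1 by apply: power01; lra.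
have := @bernoulli_ineq (- u `^ x) (b * q); rewrite lerN2 => /(_ y1).
suff : (b * q)%:R * u `^ x <= b%:R^-1 by rewrite /soft; lra.
apply: (@le_trans _ _ ((b * q)%:R * (u * u `^ eps))).
  by apply: ler_wpM2l.
have -> : (b * q)%:R * (u * u `^ eps) = b%:R * u `^ eps.
  by rewrite natrM -!mulrA; congr (_ * _); rewrite mulrA mulfV ?mul1r// pnatr_eq0; lia.
have -> : b%:R^-1 = b%:R * (b%:R ^+ 2)^-1 :> R by field; rewrite gt_eqF.
by rewrite ler_wpM2l.
Qed.

End SoftStep.

(** * Chance constraints and the mean of the soft step *)

Section SoftProbability.
Context {disp : measure_display} {T : measurableType disp} {R : realType}.
Variables (P : probability T R) (n : nat) (w : 'I_n -> {RV P >-> R}).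
Hypothesis w_ge0 : forall j t, 0 <= w j t.
Variables (q b : nat).
Hypotheses (q1 : (0 < q)%N) (b0 : (0 < b)%N).
Local Notation u := (q%:R^-1 : R).
Local Notation M := (b * q)%N.

Lemma total_size_ge0 S t : 0 <= total_size w S t.
Proof. by apply: sumr_ge0 => j _. Qed.

Lemma measurable_total_size S : measurable_fun setT (total_size w S).
Proof.
rewrite (_ : total_size w S = fun t => \sum_(j <- enum S) w j t).
  by apply: measurable_sum => j; exact: measurable_funP.
by apply/funext => t; rewrite /total_size big_enum.
Qed.

Lemma measurable_fits (cap : R) S :
  measurable [set t | total_size w S t <= cap]%classic.
Proof.
rewrite (_ : [set t | _]%classic = (total_size w S @^-1` `]-oo, cap])%classic).
  rewrite -[X in measurable X]setTI; exact: measurable_total_size.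
by apply/seteqP; split=> t /=; rewrite in_itv.
Qed.

Lemma tame_soft S : tame (fun t => soft M (u `^ total_size w S t)).
Proof.
split.
  rewrite /soft; apply: measurable_funB => //; apply: measurable_funX.
  apply: measurable_funB => //.
  apply: (measurableT_comp (measurable_powRr _)); exact: measurable_total_size.
exists 1 => t; have /andP[? ?] := soft01 M (power01 q1 (total_size_ge0 S t)).
by rewrite ger0_norm.
Qed.

(** Pointwise, the indicator of size at most 1 is below the soft step plus 1/b. *)
Lemma fits_mean_soft (p : R) S : fits w 1 p S ->
  p - b%:R^-1 <= mean P (fun t => soft M (u `^ total_size w S t)).
Proof.
move=> fS; have mA := measurable_fits 1 S.
have {fS}pA : p <= mean P \1_([set t | total_size w S t <= 1]%classic).
  by rewrite mean_indic// -lee_fin fineK// fin_num_measure.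
apply: le_trans (lerB pA (lexx _)) _.
rewrite -[in leLHS](mean_cst P b%:R^-1) lerBlDr -meanD//; first last.
  exact: tame_cst.
  exact: tame_soft.
apply: le_mean; [exact: tame_indic|apply: tameD; [exact: tame_soft|exact: tame_cst]|].
move=> t; have s0 := total_size_ge0 S t.
have /andP[f0 f1] := soft01 M (power01 q1 s0); rewrite indicE.
have [|_] := boolP (t \in _).
  by rewrite inE /= => s1; have := soft_lower q1 b0 s1 s0; lra.
by rewrite addr_ge0// invr_ge0.
Qed.

(** Pointwise, the soft step is below the indicator of size at most 1 + eps plus 1/b; the relaxed
    capacity absorbs the zone where the step falls. *)
Lemma mean_soft_fits (eps p : R) S : 0 < eps -> u `^ eps <= (b%:R ^+ 2)^-1 ->
  p + b%:R^-1 <= mean P (fun t => soft M (u `^ total_size w S t)) ->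
  fits w (1 + eps) p S.
Proof.
move=> eps0 ue h; have mA := measurable_fits (1 + eps) S.
suff pA : p <= mean P \1_([set t | total_size w S t <= 1 + eps]%classic).
  by move: pA; rewrite mean_indic// -lee_fin fineK// fin_num_measure.
rewrite -(lerD2r b%:R^-1); apply: le_trans h _.
rewrite -[in leRHS](mean_cst P b%:R^-1) -meanD//; first last.
- exact: tame_cst.
- exact: tame_indic.
apply: le_mean; [exact: tame_soft|apply: tameD; [exact: tame_indic|exact: tame_cst]|].
move=> t; have s0 := total_size_ge0 S t.
have /andP[f0 f1] := soft01 M (power01 q1 s0); rewrite indicE.
have bi : 0 <= b%:R^-1 :> R by rewrite invr_ge0.
have [_|] := boolP (t \in _); first by rewrite -[leLHS]addr0 lerD.
rewrite notin_setE /= => /negP; rewrite -ltNge => /ltW ex; rewrite add0r.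
exact: soft_upper eps0 ue ex.
Qed.

Definition moment (k : nat) (j : 'I_n) : R := mean P (fun t => (u ^+ k) `^ w j t).

Lemma power_ge01 k x : 0 <= x -> 0 <= (u ^+ k) `^ x <= 1.
Proof.
move=> x0; have /andP[u0 u1] := base01 R q1.
rewrite powR_ge0/= -[X in _ <= X](powRr0 (u ^+ k)); apply: ger_powR => //.
by rewrite exprn_gt0// exprn_ile1// ltW.
Qed.

Lemma tame_moment k j : tame (fun t => (u ^+ k) `^ w j t).
Proof.
split; first by apply: (measurableT_comp (measurable_powRr _)); exact: measurable_funP.
by exists 1 => t; have /andP[? ?] := power_ge01 k (w_ge0 j t); rewrite ger0_norm.
Qed.

Lemma moment01 k j : 0 <= moment k j <= 1.
Proof. by apply: mean01; [exact: tame_moment|move=> t; exact: power_ge01]. Qed.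

Lemma power_total_size k S t :
  (u `^ total_size w S t) ^+ k = \prod_(j in S) (u ^+ k) `^ w j t.
Proof.
have /andP[u0 u1] := base01 R q1.
have uk0 : 0 < u ^+ k by rewrite exprn_gt0.
rewrite -powR_mulrn ?powR_ge0// powRAC powR_mulrn ?ltW//.
rewrite /total_size; elim/big_rec2: _ => [|j x y _ <-]; first by rewrite powRr0.
by rewrite powRD//; apply/implyP => _; rewrite gt_eqF.
Qed.

(** The k-th power of u^w(S) is the product over S of the (u^k)^w_j, so independence turns each term
    of the binomial expansion into a product of moments. *)
Lemma mean_soft (w_indep : mutually_independent w) S :
  mean P (fun t => soft M (u `^ total_size w S t)) =
  \sum_(k < M) (soft_coef M k)%:~R * \prod_(j in S) moment k.+1 j.
Proof.
pose Y k j (x : R) := if j \in S then (u ^+ k) `^ x else 1.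
have YE k t : (u `^ total_size w S t) ^+ k = \prod_j Y k j (w j t).
  by rewrite power_total_size big_mkcond.
have Y01 k j t : 0 <= Y k j (w j t) <= 1.
  by rewrite /Y; case: ifP => _; [exact: power_ge01|rewrite ler01 lexx].
have mY k j : measurable_fun setT (Y k j).
  by rewrite /Y; case: (_ \in _); [exact: measurable_powRr|exact: measurable_cst].
have tY k : tame (fun t => \prod_j Y k j (w j t)).
  apply: tame_prod => j; split.
    by apply: measurableT_comp => //; exact: measurable_funP.
  by exists 1 => t; have /andP[? ?] := Y01 k j t; rewrite ger0_norm.
transitivity (mean P (fun t => \sum_(k < M) (soft_coef M k)%:~R * \prod_j Y k.+1 j (w j t))).
  congr mean; apply/funext => t; rewrite soft_expand.
  by apply: eq_bigr => k _; rewrite YE.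
rewrite mean_sum => [|k]; last exact: tameZ.
apply: eq_bigr => k _; rewrite meanZ// mean_prod_independent//.
congr (_ * _); rewrite [RHS]big_mkcond; apply: eq_bigr => j _; rewrite /Y; case: ifP => // _.
exact: mean_cst.
Qed.

End SoftProbability.

(** * Program logic with time bounds *)

Section ProgramLogic.
Variables (orc : oracle) (B N : nat).

(** Bounds the length of a value in units of [B.+1] bits when memory cells have absolute value at
    most [2 ^ B]: lengths add under multiplication, and the successor leaves room for a carry. *)
Fixpoint eweight (e : expr) : nat :=
  match e with
  | Cst z => `|z|%N
  | Get _ _ => 1
  | Bin _ e1 e2 => (eweight e1 + eweight e2).+1
  end.

Fixpoint ecost (e : expr) : nat :=
  match e with
  | Cst z => `|z|%N.+1
  | Get _ e1 => (ecost e1).+1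
  | Bin _ e1 e2 => (ecost e1 + ecost e2 + (eweight e1 + eweight e2).+2)%N
  end.

(* Depends on the text of the program only: [b] bounds the number of bits of the
   stored numbers and [k] the number of iterations of each loop. *)
Fixpoint ctime (b k : nat) (c : com) : nat :=
  match c with
  | Skip => 1
  | Set_ _ e1 e2 => ((ecost e1 + ecost e2) * b).+1
  | Query _ e1 e2 e3 e4 e5 =>
      ((ecost e1 + ecost e2 + ecost e3 + ecost e4 + ecost e5 + 3) * b).+1
  | Seq c1 c2 => ctime b k c1 + ctime b k c2
  | If e1 e2 c1 c2 =>
      ((ecost e1 + ecost e2) * b + (ctime b k c1 + ctime b k c2)).+1
  | While e1 e2 c1 => k.+1 * ((ecost e1 + ecost e2) * b + ctime b k c1).+1
  end%N.

(** For a fixed text the nesting depth of loops is fixed, so the factors [pk] they contribute stay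
    polynomial. *)
Lemma ctime_poly (pb pk : {poly nat}) c :
  exists p : {poly nat}, forall x, ctime pb.[x] pk.[x] c = p.[x].
Proof.
have aE (m n : nat) : (m + n)%R = (m + n)%N by [].
have mE (m n : nat) : (m * n)%R = (m * n)%N by [].
have sE (m : nat) : (m + 1)%R = m.+1 by rewrite aE addn1.
elim: c => [|a e1 e2|a e1 e2 e3 e4 e5|c1 [p1 h1] c2 [p2 h2]
  |e1 e2 c1 [p1 h1] c2 [p2 h2]|e1 e2 c1 [p1 h1]] /=.
- by exists 1 => x; rewrite hornerC.
- by exists ((ecost e1 + ecost e2)%N%:P * pb + 1) => x;
    rewrite !hornerE sE.
- by exists ((ecost e1 + ecost e2 + ecost e3 + ecost e4 + ecost e5 + 3)%N%:P * pb + 1) => x;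
    rewrite !hornerE sE.
- by exists (p1 + p2) => x; rewrite hornerD h1 h2.
- by exists ((ecost e1 + ecost e2)%N%:P * pb + (p1 + p2) + 1) => x;
    rewrite h1 h2 !hornerE sE.
- by exists ((pk + 1) * ((ecost e1 + ecost e2)%N%:P * pb + p1 + 1)) => x;
    rewrite h1 !hornerE !sE.
Qed.

Definition bounded (s : store) : Prop := forall a i, (`|s a i| <= 2 ^ B)%N.

Lemma bitlen_le z k : (`|z| <= 2 ^ k)%N -> (bitlen z <= k.+1)%N.
Proof.
by move=> h; rewrite /bitlen ltnS -(@trunc_expnK 2 k) //; apply: leq_trunc_log.
Qed.

Lemma absz_divz_le (x y : int) : (`|(x %/ y)%Z| <= `|x|)%N.
Proof.
have [->|y0] := eqVneq y 0; first by rewrite divz0.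
wlog yp : y y0 / 0 < y => [h|].
  have [|yn] := ltP 0 y; first exact: h.
  by rewrite -[y]opprK divzN abszN; apply: h; lia.
have := divz_eq x y; have := modz_ge0 x y0; have := ltz_pmod x yp.
by nia.
Qed.

Lemma aeval_le s e : bounded s ->
  (`|aeval s e| <= 2 ^ (eweight e * B.+1))%N.
Proof.
move=> bs; elim: e => [z|a e _|o e1 h1 e2 h2] /=.
- by apply: leq_trans (ltnW (ltn_expl _ (ltnSn 1))) _; rewrite leq_exp2l// leq_pmulr.
- by apply: leq_trans (bs _ _) _; rewrite leq_exp2l// mul1n.
set x := aeval s e1 in h1 *; set y := aeval s e2 in h2 *.
set p := (eweight e1 * _)%N in h1; set q := (eweight e2 * _)%N in h2.
have le1 k : (1 <= 2 ^ k)%N by rewrite expn_gt0.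
have Px := le1 p; have Py := le1 q.
have hb : (2 ^ p * 2 ^ q * 2 <= 2 ^ ((eweight e1 + eweight e2).+1 * B.+1))%N.
  by rewrite -expnD -expnSr leq_pexp2l// mulSn mulnDl -/p -/q; lia.
have hd := absz_divz_le x y; apply: leq_trans hb; case: o => /=; nia.
Qed.

Lemma acost_le s e : bounded s -> (acost s e <= ecost e * B.+1)%N.
Proof.
move=> bs; have bl e' : (bitlen (aeval s e') <= (eweight e').+1 * B.+1)%N.
  apply: leq_trans (bitlen_le (aeval_le e' bs)) _; rewrite mulSn; lia.
elim: e => [z|a e h|o e1 h1 e2 h2].
- exact: (bl (Cst z)).
- rewrite [acost _ _]/= [ecost _]/= mulSn addnC leq_add//.
  exact: bitlen_le (bs _ _).
- by rewrite [acost _ _]/= [ecost _]/= !mulnDl !leq_add//; apply: (bl (Bin o e1 e2)).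
Qed.

(** Total correctness with a time bound that depends on the text only, so that loop invariants never
    mention time. Boundedness of the memory, passed on from each command to the next, is what makes
    the bound valid. *)
Definition wp (c : com) (Q : store -> Prop) (s : store) : Prop :=
  bounded s -> exists s' t,
    [/\ exec orc c s s' t, (t <= ctime B.+1 N c)%N, bounded s' & Q s'].

Lemma wp_conseq c (Q Q' : store -> Prop) s :
  (forall s', Q s' -> Q' s') -> wp c Q s -> wp c Q' s.
Proof.
move=> h w /w [s' [t [e ? ? q]]]; exists s', t; split=> //; exact: h.
Qed.

Lemma wp_skip (Q : store -> Prop) s : Q s -> wp Skip Q s.
Proof. by move=> q bs; exists s, 1%N; split=> //; constructor. Qed.

Lemma bounded_upd s a i z : bounded s -> (`|z| <= 2 ^ B)%N -> bounded (upd s a i z).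
Proof. by move=> bs bz b k; rewrite /upd; case: ifP. Qed.

Lemma wp_set a e1 e2 (Q : store -> Prop) s :
  (`|aeval s e2| <= 2 ^ B)%N ->
  Q (upd s a (aeval s e1) (aeval s e2)) -> wp (Set_ a e1 e2) Q s.
Proof.
move=> b2 q bs; exists (upd s a (aeval s e1) (aeval s e2)).
exists (acost s e1 + acost s e2).+1; split=> //; first by constructor.
- by rewrite /= ltnS mulnDl leq_add// acost_le.
- exact: bounded_upd.
Qed.

(** The precision is bounded by [B] and not by [2 ^ B], because a query is charged the number of
    requested bits. The size of the answers has to be assumed, the oracle being arbitrary here. *)
Lemma wp_query a e1 e2 e3 e4 e5 (Q : store -> Prop) s :
  let ans := orc (aeval s e1) (aeval s e2) (aeval s e3) (aeval s e4) (aeval s e5) in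
  (`|aeval s e5| <= B)%N -> (`|ans.1| <= 2 ^ B)%N -> (`|ans.2| <= 2 ^ B)%N ->
  Q (upd (upd s a 0 ans.1) a 1 ans.2) -> wp (Query a e1 e2 e3 e4 e5) Q s.
Proof.
move=> ans bm b1 b2 q bs; do 2 eexists; split; last exact: q.
- exact: ExQuery.
- rewrite /= ltnS; set b := B.+1; rewrite !mulnDl.
  have := acost_le e1 bs; have := acost_le e2 bs; have := acost_le e3 bs.
  have := acost_le e4 bs; have := acost_le e5 bs.
  have := bitlen_le b1; have := bitlen_le b2; rewrite -/b.
  have : (B <= b)%N by []; move: bm; rewrite -/ans; lia.
- by do 2 (apply: bounded_upd => //).
Qed.

Lemma wp_seq c1 c2 (Q : store -> Prop) s :
  wp c1 (wp c2 Q) s -> wp (Seq c1 c2) Q s.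
Proof.
move=> w1 /w1 [s1 [t1 [e1 l1 bs1 /(_ bs1) [s2 [t2 [e2 l2 bs2 q]]]]]].
exists s2, (t1 + t2)%N; split=> //; first exact: ExSeq e1 e2.
exact: leq_add.
Qed.

Lemma wp_if e1 e2 c1 c2 (Q : store -> Prop) s :
  (aeval s e1 <= aeval s e2 -> wp c1 Q s) ->
  (aeval s e2 < aeval s e1 -> wp c2 Q s) -> wp (If e1 e2 c1 c2) Q s.
Proof.
move=> w1 w2 bs; have a1 := acost_le e1 bs; have a2 := acost_le e2 bs.
have [h|h] := leP (aeval s e1) (aeval s e2).
- have [s' [t [e l bs' q]]] := w1 h bs.
  exists s', (acost s e1 + acost s e2 + t).+1; split=> //; first exact: ExIfTrue.
  by rewrite /= ltnS mulnDl; lia.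
- have [s' [t [e l bs' q]]] := w2 h bs.
  exists s', (acost s e1 + acost s e2 + t).+1; split=> //; first exact: ExIfFalse.
  by rewrite /= ltnS mulnDl; lia.
Qed.

(** The index of the invariant is an upper bound on the remaining iterations and acts as the
    variant; [N] bounds its initial value for all loops at once. *)
Lemma wp_while (I : nat -> store -> Prop) e1 e2 c (Q : store -> Prop) k s :
  (forall k s, I k s -> aeval s e1 <= aeval s e2 ->
     exists2 k', k = k'.+1 & wp c (I k') s) ->
  (forall k s, I k s -> aeval s e2 < aeval s e1 -> Q s) ->
  (k <= N)%N -> I k s -> wp (While e1 e2 c) Q s.
Proof.
move=> hI hQ kN Is bs.
suff [s' [t [e l bs' q]]] : exists s' t,
    [/\ exec orc (While e1 e2 c) s s' t,
        (t <= k.+1 * ((ecost e1 + ecost e2) * B.+1 + ctime B.+1 N c).+1)%N,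
        bounded s' & Q s'].
  exists s', t; split=> //; apply: leq_trans l _ => /=.
  by rewrite leq_mul2r; apply/orP; right.
elim: k s bs Is {kN} => [|k IH] s bs Is;
    have a1 := acost_le e1 bs; have a2 := acost_le e2 bs;
    have [h|h] := leP (aeval s e1) (aeval s e2).
- by have [] := hI _ _ Is h.
- exists s, (acost s e1 + acost s e2).+1; split=> //; first exact: ExWhileFalse.
    by rewrite /= mul1n ltnS mulnDl; lia.
  exact: hQ Is h.
- have [k' [kk'] w] := hI _ _ Is h; subst k'.
  have [s1 [t1 [x1 l1 bs1 Is1]]] := w bs.
  have [s2 [t2 [x2 l2 bs2 q]]] := IH _ bs1 Is1.
  exists s2, (acost s e1 + acost s e2 + t1 + t2).+1; split=> //.
    exact: ExWhileTrue x1 x2.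
  by rewrite mulSn addSn ltnS leq_add// mulnDl; lia.
- exists s, (acost s e1 + acost s e2).+1; split=> //; first exact: ExWhileFalse.
    by rewrite /= mulSn addSn ltnS mulnDl; lia.
  exact: hQ Is h.
Qed.

End ProgramLogic.

(** * The dynamic program *)

Section Digits.
Variable r : nat.

(** States are numbers in base [r + 1]. Digit [i * M + k] stands for [r] times the product of the
    moments of order [k + 1] over knapsack [i]. *)
Definition digit (c s : nat) : nat := ((s %/ r.+1 ^ c) %% r.+1)%N.

Definition encode (D : nat) (g : nat -> nat) : nat :=
  (\sum_(c < D) g c * r.+1 ^ c)%N.

Lemma digit_le c s : (digit c s <= r)%N.
Proof. by rewrite -ltnS ltn_mod. Qed.

Lemma encodeS D g : encode D.+1 g = (encode D g + g D * r.+1 ^ D)%N.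
Proof. exact: big_ord_recr. Qed.

Lemma encode_lt D g : (forall c, g c <= r)%N -> (encode D g < r.+1 ^ D)%N.
Proof.
move=> gr; elim: D => [|D IH]; first by rewrite /encode big_ord0.
rewrite encodeS expnS mulSn; have := gr D; nia.
Qed.

Lemma digit_encode D g c : (forall c, g c <= r)%N -> (c < D)%N ->
  digit c (encode D g) = g c.
Proof.
move=> gr; elim: D => // D IH; rewrite ltnS leq_eqVlt => /predU1P[->|cD].
  rewrite encodeS /digit addnC divnMDl ?expn_gt0// divn_small ?encode_lt//.
  by rewrite addn0 modn_small// ltnS.
have -> : digit c (encode D.+1 g) = digit c (encode D g); last exact: IH.
rewrite encodeS /digit addnC.
have [q ->] : exists q, (r.+1 ^ D = q * r.+1 * r.+1 ^ c)%N.
  by exists (r.+1 ^ (D - c.+1))%N; rewrite -expnSr -expnD addSnnS subnK.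
by rewrite !mulnA divnMDl ?expn_gt0// modnMDl.
Qed.

Lemma encode_max D : encode D (fun=> r) = (r.+1 ^ D).-1.
Proof.
elim: D => [|D IH]; first by rewrite /encode big_ord0.
by rewrite encodeS IH expnS mulSn; have := expn_gt0 r.+1 D; lia.
Qed.

Lemma digit_max D c : (c < D)%N -> digit c (r.+1 ^ D).-1 = r.
Proof. by move=> cD; rewrite -encode_max digit_encode. Qed.

End Digits.

(** Of the error 3, the integer part of z a / r accounts for 1, and using a instead of r e for 2,
    because z / r <= 1. *)
Lemma scaled_digit_error (F : realFieldType) (q z a r e : F) :
  0 < r -> 0 <= z -> z <= r -> q * r <= z * a -> z * a <= (q + 1) * r ->
  `|a - r * e| <= 2 -> `|q - z * e| <= 3.
Proof.
move=> r0 z0 zr h1 h2; rewrite ler_norml => /andP[a2 a1].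
have k1 : z * (a - r * e) <= r * 2.
  apply: (@le_trans _ _ (z * 2)); first exact: ler_wpM2l.
  by rewrite ler_wpM2r.
have k2 : - (r * 2) <= z * (a - r * e).
  apply: (@le_trans _ _ (z * - 2)); last exact: ler_wpM2l.
  by rewrite mulrN lerN2 ler_wpM2r.
rewrite ler_norml; apply/andP; split; rewrite -(ler_pM2l r0).
  by move: h2 k2; lra.
by move: h1 k1; lra.
Qed.

Section DynamicProgram.
Variables (d M r : nat) (a : nat -> nat -> nat) (v : nat -> nat).
Variable ok : nat -> bool.
Hypothesis ar : forall l k, (a l k <= r)%N.

Definition scaled_digit (l i s c : nat) : nat :=
  if (c %/ M)%N == i then (digit r c s * a l (c %% M) %/ r)%N else digit r c s.

Definition insert (l i s : nat) : nat := encode r (d * M) (scaled_digit l i s).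

Lemma scaled_digit_le l i s c : (scaled_digit l i s c <= r)%N.
Proof.
rewrite /scaled_digit; case: ifP => _; last exact: digit_le.
apply: leq_trans (leq_div2r _ (leq_mul (digit_le r c s) (ar l _))) _.
by case: (r) => // k; rewrite mulnK.
Qed.

Lemma insert_lt l i s : (insert l i s < r.+1 ^ (d * M))%N.
Proof. exact: encode_lt (scaled_digit_le _ _ _). Qed.

(* Choice 0 leaves the item out, choice [i + 1] puts it into knapsack [i]. *)
Definition place (l c s : nat) : nat := if c is i.+1 then insert l i s else s.

Lemma place_lt l c s :
  (s < r.+1 ^ (d * M))%N -> (place l c s < r.+1 ^ (d * M))%N.
Proof. by case: c => //= i _; exact: insert_lt. Qed.

(** The accumulator holds a value, a choice and the resulting state. The test [0 < V s'] excludes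
    states without accepted continuation, which would seem feasible once [v l] is added. *)
Definition improve (V : nat -> nat) (l s : nat) (acc : nat * nat * nat) (i : nat) :=
  let s' := insert l i s in
  if (0 < V s')%N && (acc.1.1 < V s' + v l)%N then ((V s' + v l)%N, i.+1, s')
  else acc.

Definition layer (V : nat -> nat) (l s : nat) : nat * nat * nat :=
  foldl (improve V l s) (V s, 0%N, s) (iota 0 d).

(* One more than the best profit of items [0 .. l-1] from state [s], or 0 if
   no placement of these items leads to an accepted state. *)
Fixpoint value (l s : nat) : nat :=
  if l is l'.+1 then (layer (value l') l' s).1.1 else ok s.

Definition choice_at (l s : nat) : nat := (layer (value l) l s).1.2.
Definition next_state (l s : nat) : nat := (layer (value l) l s).2.

(** Items are placed from the last to the first, and [value l] describes what items below [l] can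
    still achieve. Following the recorded choices from the initial state thus recovers an optimal
    solution without a search over final states. *)
Fixpoint greedy (l s : nat) : nat -> nat :=
  if l is l'.+1 then
    fun j => if j == l' then choice_at l' s else greedy l' (next_state l' s) j
  else fun=> 0%N.

Fixpoint run (l : nat) (ch : nat -> nat) (s : nat) : nat :=
  if l is l'.+1 then run l' ch (place l' (ch l') s) else s.

Definition gain (l : nat) (ch : nat -> nat) : nat :=
  (\sum_(j < l) (0 < ch j) * v j)%N.

Lemma layerP V l s (acc := layer V l s) :
  [/\ acc.2 = place l acc.1.2 s, acc.1.1 = (V acc.2 + (0 < acc.1.2) * v l)%N,
      (0 < acc.1.2)%N -> (0 < V acc.2)%N & (acc.1.2 <= d)%N].
Proof.
have : {in iota 0 d, forall i, i < d}%N by move=> i; rewrite mem_iota.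
have : [/\ (V s, 0%N, s).2 = place l (V s, 0%N, s).1.2 s,
  (V s, 0%N, s).1.1 = (V (V s, 0%N, s).2 + (0 < (V s, 0%N, s).1.2) * v l)%N,
  (0 < (V s, 0%N, s).1.2)%N -> (0 < V (V s, 0%N, s).2)%N &
  ((V s, 0%N, s).1.2 <= d)%N] by split=> //=; rewrite addn0.
rewrite {}/acc /layer; elim: (iota 0 d) (V s, 0%N, s) => // i t IH acc h it.
apply: IH => [|j jt]; last by apply: it; rewrite inE jt orbT.
rewrite /improve; case: ifP => // /andP[V0 _]; split=> //=.
  by rewrite mul1n.
by apply: it; rewrite mem_head.
Qed.

(** The accumulated value never decreases, so it suffices to inspect the step of the fold that tries
    knapsack [i]. *)
Lemma layer_ge V l s c : (c <= d)%N -> (0 < V (place l c s))%N ->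
  (V (place l c s) + (0 < c) * v l <= (layer V l s).1.1)%N.
Proof.
have mono t acc : (acc.1.1 <= (foldl (improve V l s) acc t).1.1)%N.
  elim: t acc => //= i t IH acc; apply: leq_trans (IH _).
  by rewrite /improve; case: ifP => // /andP[_ /ltnW].
case: c => [|i] cd V0; first by rewrite addn0; exact: (mono _ (V s, 0%N, s)).
rewrite /layer; have -> : d = (i + (d - i.+1).+1)%N by lia.
rewrite iotaD foldl_cat /=; apply: leq_trans (mono _ _).
by rewrite /improve V0/= mul1n; case: ltnP.
Qed.

Lemma value_ge l ch s : (forall j, ch j <= d)%N -> ok (run l ch s) ->
  (gain l ch < value l s)%N.
Proof.
move=> chd; elim: l s => [|l IH] s /=; first by rewrite /gain big_ord0 => ->.
move=> /IH lt; apply: leq_trans (layer_ge (chd l) (leq_trans (ltn0Sn _) lt)).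
by rewrite /gain big_ord_recr /= -addSn leq_add2r.
Qed.

Lemma eq_run l ch ch' s : (forall j, (j < l)%N -> ch j = ch' j) ->
  run l ch s = run l ch' s.
Proof.
elim: l s => //= l IH s e; rewrite e// IH// => j jl; exact/e/ltnW.
Qed.

Lemma greedyP l s (ch := greedy l s) : (0 < value l s)%N ->
  ok (run l ch s) /\ value l s = (gain l ch).+1.
Proof.
rewrite {}/ch; elim: l s => [|l IH] s /=.
  by rewrite /gain big_ord0; case: (ok s).
have [] := layerP (value l) l s; rewrite -/(choice_at l s) -/(next_state l s).
move=> e1 -> pos _ V0.
(* If the item is left out, the positive value is that of the next state; otherwise positivity was
   tested by [improve]. *)
have {}V0 : (0 < value l (next_state l s))%N.
  by case: (posnP (choice_at l s)) pos V0 => [_ _|_ ->//]; rewrite mul0n addn0.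
have [okr ->] := IH _ V0; rewrite eqxx -e1; split.
  by rewrite (@eq_run _ _ (greedy l (next_state l s)))// => j jl; rewrite ltn_eqF.
rewrite /gain big_ord_recr/= eqxx addSn; congr (_ + _).+1.
by apply: eq_bigr => j _; rewrite ltn_eqF.
Qed.

Lemma greedy_le l s j : (greedy l s j <= d)%N.
Proof.
elim: l s => //= l IH s; case: eqP => // _.
by have [] := layerP (value l) l s.
Qed.

Lemma value_le l s : (value l s <= (\sum_(j < l) v j).+1)%N.
Proof.
elim: l s => [|l IH] s /=; first by rewrite big_ord0; case: (ok s).
have [_ -> _ _] := layerP (value l) l s.
rewrite big_ord_recr /= -addSn leq_add//; by case: (0 < _)%N; rewrite ?mul1n.
Qed.

Lemma choice_at_le l s : (choice_at l s <= d)%N.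
Proof. by have [] := layerP (value l) l s. Qed.

Lemma next_state_lt l s :
  (s < r.+1 ^ (d * M))%N -> (next_state l s < r.+1 ^ (d * M))%N.
Proof.
move=> sK; rewrite /next_state; have [-> _ _ _] := layerP (value l) l s.
exact: place_lt sK.
Qed.

(** The error made at one item is multiplied by the exact factors of the items still to come, which
    lie in [0, 1]; so the errors, at most 3 per item, simply add up. *)
Lemma digit_run_error (F : realFieldType) (e : nat -> nat -> F) l ch s c :
  (0 < r)%N -> (c < d * M)%N ->
  (forall j k, (j < l)%N -> (k < M)%N ->
     0 <= e j k <= 1 /\ `|(a j k)%:R - r%:R * e j k| <= 2) ->
  `|(digit r c (run l ch s))%:R
    - (digit r c s)%:R * \prod_(j < l | ch j == (c %/ M)%N.+1) e j (c %% M)%N|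
  <= 3 * l%:R.
Proof.
move=> r0 cD; elim: l s => [|l IH] s he /=.
  by rewrite big_ord0 mulr1 subrr normr0 mulr0.
have M0 : (0 < M)%N by case: (M) cD; rewrite ?muln0.
set s' := place l (ch l) s.
have {}IH := IH s' (fun j k jl => he j k (ltnW jl)).
set x := (digit r c s)%:R; set x' := (digit r c s')%:R in IH.
set pi := \prod_(_ < l | _) _ in IH.
have pi01 : 0 <= pi <= 1.
  have he' (j : 'I_l) := he j (c %% M)%N (ltnW (ltn_ord j)) (ltn_pmod c M0).
  rewrite /pi; apply/andP; split.
    by apply: prodr_ge0 => j _; have [/andP[]] := he' j.
  by apply: prodr_ile1 => j _; have [] := he' j.
rewrite big_mkcond big_ord_recr -big_mkcond/= -/pi.
set el := if _ then _ else _.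
have hx : `|x' - x * el| <= 3.
  rewrite /x' /s' /el /x; case: (ch l) => [|i] /=.
    by rewrite mulr1 subrr normr0.
  rewrite digit_encode//; last exact: scaled_digit_le.
  rewrite /scaled_digit eqSS eq_sym; case: eqP => _; last by rewrite mulr1 subrr normr0.
  have [/andP[e0 e1] ae] := he l (c %% M)%N (ltnSn l) (ltn_pmod c M0).
  set z := digit r c s; set al := a l _ in ae *; set ee := e l _ in e0 e1 ae *.
  have zr : (z <= r)%N by exact: digit_le.
  have h1 : (z * al %/ r * r <= z * al)%N by exact: leq_trunc_div.
  have h2 : (z * al < (z * al %/ r).+1 * r)%N by exact: ltn_ceil.
  set q := (z * al %/ r)%N in h1 h2 *.
  have r0F : 0 < r%:R :> F by rewrite ltr0n.
  have zrF : z%:R <= r%:R :> F by rewrite ler_nat.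
  have z0F : 0 <= z%:R :> F by [].
  have h1F : q%:R * r%:R <= z%:R * al%:R :> F by rewrite -!natrM ler_nat.
  have h2F : z%:R * al%:R <= (q%:R + 1) * r%:R :> F.
    by rewrite natr1 -!natrM ler_nat ltnW.
  exact: (scaled_digit_error (r := r%:R) (a := al%:R)).
apply: le_trans (_ : `|(digit r c (run l ch s'))%:R - x' * pi| + `|x' - x * el| <= _).
  rewrite (_ : _ - _ = ((digit r c (run l ch s'))%:R - x' * pi) + (x' - x * el) * pi); last by ring.
  apply: le_trans (ler_normD _ _) _; rewrite lerD2l normrM.
  by case/andP: pi01 => p0 p1; rewrite (ger0_norm p0) ler_piMr.
by rewrite -[l.+1]addn1 natrD mulrDr mulr1 lerD.
Qed.
End DynamicProgram.

(** * The program and its correctness *)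

Section Program.
Variables (d M q b C : nat) (coef th : nat -> int).

(* Arrays 0 and 1 hold the input and 2 .. d + 1 the output. *)
Definition arr (x : nat) : nat := (d.+2 + x)%N.
Local Notation vals := (arr 1).
Local Notation choices := (arr 2).
Local Notation nexts := (arr 3).
(** A query writes to cells 0 and 1 of an array named by a literal, so each moment gets an array of
    its own. *)
Definition answers (k : nat) : nat := arr k.+4.

Definition var (x : nat) : expr := Get (arr 0) (Cst (Posz x)).
Definition assign (x : nat) (e : expr) : com := Set_ (arr 0) (Cst (Posz x)) e.
Local Notation prec := 0%N.
Local Notation scale := 1%N.
Local Notation state := 2%N.
Local Notation item := 3%N.
Local Notation nstates := 4%N.

(* Locked so that simplification treats these expressions as atoms. *)
Definition topE : expr := locked (Bin Add (var scale) (Cst (Posz 2))).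
Definition radixE : expr := locked (Bin Add (var scale) (Cst (Posz 3))).

Fixpoint powE (c : nat) : expr :=
  if c is c'.+1 then Bin Mul radixE (powE c') else Cst (Posz 1).

Definition digitE (c : nat) : expr :=
  let t := Bin Div (var state) (powE c) in
  locked (Bin Defs.Sub t (Bin Mul (Bin Div t radixE) radixE)).

Fixpoint encodeE (D : nat) (g : nat -> expr) : expr :=
  if D is D'.+1 then Bin Add (encodeE D' g) (Bin Mul (g D') (powE D'))
  else Cst (Posz 0).

(** The oracle errs by at most one unit, so its answer may be -1; adding 1 makes it nonnegative, in
    agreement with [rounded]. *)
Definition insertE (i : nat) : expr :=
  encodeE (d * M) (fun c =>
    if (c %/ M)%N == i then
      Bin Div (Bin Mul (digitE c)
        (Bin Add (Get (answers (c %% M)) (Cst (Posz 0))) (Cst (Posz 1)))) topE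
    else digitE c).

Fixpoint testE (i k : nat) : expr :=
  if k is k'.+1 then
    Bin Add (testE i k') (Bin Mul (Cst (coef k')) (digitE (i * M + k')))
  else Cst (Posz 0).

(** Loops of constant length [d] or [M] are unrolled, since array names must be literals. *)
Definition sequence (f : nat -> com) (k : nat) : com :=
  foldr (fun i c => Seq (f i) c) Skip (iota 0 k).

(** Doubling until [C n] is exceeded yields [2 ^ nbits] and counts [nbits] in the cell [prec], which
    is initially 0. *)
Definition choose_scale : com :=
  Seq (assign scale (Cst (Posz 1)))
    (While (var scale) (Bin Mul (Cst (Posz C)) (Get 0 (Cst (Posz 0))))
      (Seq (assign scale (Bin Mul (Cst (Posz 2)) (var scale)))
           (assign prec (Bin Add (var prec) (Cst (Posz 1)))))).

Definition init_value : com :=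
  foldr (fun i c => If (Bin Mul (Cst (th i)) topE)
                       (Bin Mul (Cst (Posz b)) (testE i M))
                       c (Set_ vals (var state) (Cst (Posz 0))))
    (Set_ vals (var state) (Cst (Posz 1))) (iota 0 d).

Definition for_states (c : com) : com :=
  Seq (assign state (Cst (Posz 0)))
    (While (Bin Add (var state) (Cst (Posz 1))) (var nstates)
      (Seq c (assign state (Bin Add (var state) (Cst (Posz 1)))))).

Definition cellE (l s : expr) : expr := Bin Add (Bin Mul l (var nstates)) s.
Definition newE : expr :=
  cellE (Bin Add (var item) (Cst (Posz 1))) (var state).

Definition improveC (i : nat) : com :=
  let old := Get vals (cellE (var item) (insertE i)) in
  let new := Bin Add old (Get 1 (var item)) in
  If (Cst (Posz 1)) old
    (If (Bin Add (Get vals newE) (Cst (Posz 1))) new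
      (Seq (Set_ vals newE new)
        (Seq (Set_ choices newE (Cst (Posz i.+1)))
             (Set_ nexts newE (insertE i))))
      Skip)
    Skip.

Definition layerC : com :=
  Seq (Set_ vals newE (Get vals (cellE (var item) (var state))))
    (Seq (Set_ choices newE (Cst (Posz 0)))
      (Seq (Set_ nexts newE (var state)) (sequence improveC d))).

Definition ask (k : nat) : com :=
  Query (answers k) (var item) (Cst (Posz 1)) (Cst (Posz 0))
    (Cst (Posz (q ^ k.+1))) (var prec).

Definition fill_tables : com :=
  Seq (assign item (Cst (Posz 0)))
    (While (Bin Add (var item) (Cst (Posz 1))) (Get 0 (Cst (Posz 0)))
      (Seq (sequence ask M)
        (Seq (for_states layerC)
             (assign item (Bin Add (var item) (Cst (Posz 1))))))).

(* A choice [c] is decoded arithmetically: [c - i = 1] iff [c = i + 1]. *)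
Definition trace : com :=
  Seq (assign state (Bin Defs.Sub (var nstates) (Cst (Posz 1))))
    (While (Cst (Posz 1)) (var item)
      (Seq (assign item (Bin Defs.Sub (var item) (Cst (Posz 1))))
        (Seq (sequence (fun i =>
                Set_ i.+2 (var item)
                  (Bin Defs.Sub (Get choices newE) (Cst (Posz i)))) d)
             (assign state (Get nexts newE))))).

Definition knapsack : com :=
  Seq choose_scale
    (Seq (assign nstates (powE (d * M)))
      (Seq (for_states init_value) (Seq fill_tables trace))).

(** * The program computes the tables of the dynamic program *)

Section Correctness.
Variables (orc : oracle) (B N n : nat) (v : nat -> nat) (a : nat -> nat -> nat).

Definition nbits : nat := up_log 2 (C * n).+1.
(** The answers for numbers in [0, 1] range from -1 to [2 ^ nbits + 1]; shifted by 1 they fill the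
    interval from 0 to [top]. *)
Definition top : nat := (2 ^ nbits).+2.
Local Notation r := top.
Local Notation K := (r.+1 ^ (d * M))%N.

Definition accepts (s : nat) : bool :=
  all (fun i => th i * r%:Z
    <= b%:Z * \sum_(k < M) coef k * (digit r (i * M + k) s)%:Z) (iota 0 d).

Hypothesis ar : forall l k, (a l k <= r)%N.
Hypothesis orcP : forall l k, (l < n)%N -> (k < M)%N ->
  let ans := orc l%:Z 1 0 (Posz (q ^ k.+1)) nbits%:Z in
  ans.1 = (a l k)%:Z - 1 /\ (`|ans.2| <= 2 ^ B)%N.
Hypothesis BK : (d + K + n + C * n + nbits + 2 <= B)%N.
Hypothesis Bv : (\sum_(j < n) v j < 2 ^ B)%N.
Hypothesis NK : (n + K + nbits <= N)%N.

Local Notation wp := (wp orc B N).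
Local Notation value := (value d M r a v accepts).
Local Notation choice_at := (choice_at d M r a v accepts).
Local Notation next_state := (next_state d M r a v accepts).
Local Notation greedy := (greedy d M r a v accepts).
Local Notation insert := (insert d M r a).

Lemma arr_eq x y : (arr x == arr y) = (x == y).
Proof. exact: eqn_add2l. Qed.
Lemma arr_out x i : (i < d)%N -> (arr x == i.+2) = false.
Proof. by move=> id; apply/negbTE; rewrite /arr; lia. Qed.

Lemma small_le k : (k <= B)%N -> (k <= 2 ^ B)%N.
Proof. by move=> kB; apply: leq_trans kB (ltnW (ltn_expl _ _)). Qed.

Lemma wp_sequence (f : nat -> com) (J : nat -> store -> Prop) k s :
  (forall i s, (i < k)%N -> J i s -> wp (f i) (J i.+1) s) -> J 0%N s ->
  wp (sequence f k) (J k) s.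
Proof.
move=> Jf; rewrite /sequence.
suff gen k' i s' : (i + k' = k)%N -> J i s' ->
    wp (foldr (fun i c => Seq (f i) c) Skip (iota i k')) (J k) s'.
  exact: gen.
elim: k' i s' => [|k' IH] i s' ik Ji /=.
  by apply: wp_skip; rewrite -ik addn0.
apply: wp_seq; apply: (wp_conseq (Q := J i.+1)) => [s1 Js1|].
  by apply: IH => //; rewrite addSnnS.
by apply: Jf => //; lia.
Qed.

Lemma aeval_bin st o e1 e2 :
  aeval st (Bin o e1 e2) = binop_sem o (aeval st e1) (aeval st e2).
Proof. by []. Qed.

Lemma aeval_get st x e : aeval st (Get x e) = st x (aeval st e).
Proof. by []. Qed.

Lemma aeval_radix st : st (arr 0) (Posz scale) = Posz (2 ^ nbits) ->
  aeval st radixE = Posz r.+1.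
Proof. by rewrite /radixE -lock /= => ->; rewrite /top; lia. Qed.

Lemma aeval_top st : st (arr 0) (Posz scale) = Posz (2 ^ nbits) ->
  aeval st topE = Posz r.
Proof. by rewrite /topE -lock /= => ->; rewrite /top; lia. Qed.

Lemma aeval_pow st c : st (arr 0) (Posz scale) = Posz (2 ^ nbits) ->
  aeval st (powE c) = Posz (r.+1 ^ c).
Proof.
move=> h; elim: c => // c IH.
by rewrite aeval_bin aeval_radix// IH /= -PoszM expnS.
Qed.

Lemma aeval_digit st c s : st (arr 0) (Posz scale) = Posz (2 ^ nbits) ->
  st (arr 0) (Posz state) = Posz s -> aeval st (digitE c) = Posz (digit r c s).
Proof.
move=> h1 h2; rewrite /digitE -lock /= aeval_radix// aeval_pow// h2.
rewrite /digit !divz_nat; set x := (s %/ _)%N.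
by rewrite {1}(divn_eq x r.+1) PoszD PoszM addrAC subrr add0r.
Qed.

Lemma aeval_encode st D g g' : st (arr 0) (Posz scale) = Posz (2 ^ nbits) ->
  (forall c, (c < D)%N -> aeval st (g c) = Posz (g' c)) ->
  aeval st (encodeE D g) = Posz (encode r D g').
Proof.
move=> h; elim: D => [|D IH] hg; first by rewrite /encode big_ord0.
rewrite !aeval_bin aeval_pow// IH ?hg// => [|c cD]; last exact/hg/ltnW.
by rewrite encodeS /= -PoszM -PoszD.
Qed.

Definition answered (l : nat) (st : store) : Prop :=
  forall k, (k < M)%N -> st (answers k) 0 = (a l k)%:Z - 1.

Lemma aeval_insert st l i s : st (arr 0) (Posz scale) = Posz (2 ^ nbits) ->
  st (arr 0) (Posz state) = Posz s -> answered l st ->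
  aeval st (insertE i) = Posz (insert l i s).
Proof.
move=> h1 h2 h3; apply: aeval_encode => // c cD; rewrite /scaled_digit.
case: ifP => _; last exact: aeval_digit.
have M0 : (0 < M)%N by case: (M) cD; rewrite ?muln0.
rewrite !aeval_bin (aeval_digit c h1 h2) aeval_top//= h3 ?ltn_pmod//.
by rewrite subrK -PoszM divz_nat.
Qed.

Lemma aeval_test st i k s : st (arr 0) (Posz scale) = Posz (2 ^ nbits) ->
  st (arr 0) (Posz state) = Posz s ->
  aeval st (testE i k) = \sum_(k' < k) coef k' * (digit r (i * M + k') s)%:Z.
Proof.
move=> h1 h2; elim: k => [|k IH]; first by rewrite big_ord0.
by rewrite big_ord_recr !aeval_bin (aeval_digit _ h1 h2) IH.
Qed.

Definition inputs (st : store) : Prop :=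
  st 0%N 0 = n%:Z /\ forall j, (j < n)%N -> st 1%N (Posz j) = (v j)%:Z.

Definition globals (st : store) : Prop :=
  [/\ inputs st, st (arr 0) (Posz prec) = Posz nbits,
      st (arr 0) (Posz scale) = Posz (2 ^ nbits) &
      st (arr 0) (Posz nstates) = Posz K].

(** The tables are filled row by row, in lexicographic order of the item count and the state. Row 0
    carries no choice, hence the condition [0 < l']. *)
Definition filled (l s : nat) (st : store) : Prop :=
  forall l' s', (s' < K)%N -> (l' < l)%N || ((l' == l) && (s' < s)%N) ->
  st vals (Posz (l' * K + s')) = Posz (value l' s') /\
  ((0 < l')%N -> st choices (Posz (l' * K + s')) = Posz (choice_at l'.-1 s') /\
    st nexts (Posz (l' * K + s')) = Posz (next_state l'.-1 s')).

Lemma inputs_upd st x i z : (1 < x)%N -> inputs st -> inputs (upd st x i z).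
Proof. by case: x => [|[]]. Qed.

Lemma globals_upd st x i z : (1 < x)%N -> x != arr 0 -> globals st ->
  globals (upd st x i z).
Proof.
move=> x1 x0 [g1 g2 g3 g4]; split; first exact: inputs_upd.
- by rewrite /upd eq_sym (negbTE x0).
- by rewrite /upd eq_sym (negbTE x0).
- by rewrite /upd eq_sym (negbTE x0).
Qed.

Lemma globals_set st x z : (1 < x < 4)%N -> globals st ->
  globals (upd st (arr 0) (Posz x) z).
Proof.
move=> x14 [g1 g2 g3 g4]; split; first exact: inputs_upd.
- by rewrite /upd eqxx/= eqz_nat; case: eqP => // ?; lia.
- by rewrite /upd eqxx/= eqz_nat; case: eqP => // ?; lia.
- by rewrite /upd eqxx/= eqz_nat; case: eqP => // ?; lia.
Qed.

Lemma filled_upd l s st x i z : x \notin [:: vals; choices; nexts] ->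
  filled l s st -> filled l s (upd st x i z).
Proof.
rewrite !inE !negb_or => /and3P[x1 x2 x3] f l' s' s'K l's'.
by rewrite /upd ![_ == x]eq_sym (negbTE x1) (negbTE x2) (negbTE x3); exact: f.
Qed.

(** States are below [K], so the address determines row and column, and the write misses the cells
    already filled. *)
Lemma filled_upd_cell l s st x z : (s < K)%N -> filled l s st ->
  filled l s (upd st x (Posz (l * K + s)) z).
Proof.
move=> sK f l' s' s'K l's'; have := f l' s' s'K l's'; rewrite /upd eqz_nat.
suff -> : (l' * K + s' == l * K + s)%N = false by rewrite !andbF.
apply/negbTE/eqP => e.
have K0 : (0 < K)%N by rewrite expn_gt0.
have el : l' = l.
  by have := congr1 (divn^~ K) e; rewrite !divnMDl// !divn_small// !addn0.
by subst l'; move: l's'; rewrite ltnn eqxx/=; lia.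
Qed.

Lemma filled_next l s st : filled l s st ->
  st vals (Posz (l * K + s)) = Posz (value l s) ->
  ((0 < l)%N -> st choices (Posz (l * K + s)) = Posz (choice_at l.-1 s) /\
     st nexts (Posz (l * K + s)) = Posz (next_state l.-1 s)) ->
  filled l s.+1 st.
Proof.
move=> f h1 h2 l' s' s'K; rewrite ltnS [(s' <= s)%N]leq_eqVlt => l's'.
have [e|ne] := eqVneq (l', s') (l, s); first by case: e => -> ->.
apply: f => //; move: l's' ne; rewrite xpair_eqE.
by case: (l' == l); case: (s' == s).
Qed.

Lemma filled_layer l st : filled l K st -> filled l.+1 0 st.
Proof. by move=> f l' s' s'K l's'; apply: f => //; lia. Qed.

Lemma aeval_cell st l s eL eS : globals st ->
  aeval st eL = Posz l -> aeval st eS = Posz s ->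
  aeval st (cellE eL eS) = Posz (l * K + s).
Proof. by move=> [_ _ _ /= ->] -> ->. Qed.

Lemma wp_choose_scale st : inputs st -> st (arr 0) (Posz prec) = 0 ->
  wp choose_scale (fun st' => [/\ inputs st',
    st' (arr 0) (Posz prec) = Posz nbits &
    st' (arr 0) (Posz scale) = Posz (2 ^ nbits)]) st.
Proof.
move=> h0 h1; apply: wp_seq; apply: wp_set; first by rewrite expn_gt0.
pose I k st' := exists m, [/\ (k + m = nbits)%N, inputs st',
  st' (arr 0) (Posz prec) = Posz m & st' (arr 0) (Posz scale) = Posz (2 ^ m)].
apply: (wp_while (I := I) (k := nbits)).
- move=> k s [m [km hs hm hQ]] /=; rewrite hQ hs.1 => le1.
  have {}le1 : (2 ^ m <= C * n)%N by move: le1; rewrite -PoszM lez_nat.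
  have lt1 : (m < nbits)%N.
    rewrite -(@ltn_exp2l 2)//; apply: leq_trans (up_logP _ (ltnSn 1)).
    by rewrite ltnS.
  exists k.-1; first lia.
  have p0 : (2 * 2 ^ m <= 2 ^ B)%N by rewrite -expnS leq_exp2l//; lia.
  apply: wp_seq; apply: wp_set; rewrite /= hQ -?PoszM //.
  apply: wp_set; rewrite /= /upd !eqxx/= hm -PoszD; first by apply: small_le; lia.
  exists m.+1; split; rewrite /upd ?eqxx/=; first lia.
  + by rewrite /inputs /=.
  + by rewrite addn1.
  + by rewrite -expnS.
- move=> k s [m [km hs hm hQ]] /=; rewrite hQ hs.1 => lt1.
  have {}lt1 : (C * n < 2 ^ m)%N by move: lt1; rewrite -PoszM ltz_nat.
  have em : m = nbits.
    by apply/eqP; rewrite eqn_leq; apply/andP; split; [lia|exact: up_log_min].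
  by split; rewrite -?em.
- lia.
- exists 0%N; split; rewrite /upd ?eqxx//=; lia.
Qed.

Lemma wp_for_states c (J : nat -> store -> Prop) st :
  (forall s st, (s < K)%N -> globals st -> st (arr 0) (Posz state) = Posz s ->
    J s st -> wp c (fun st' => [/\ globals st',
      st' (arr 0) (Posz state) = Posz s & J s.+1 st']) st) ->
  (forall s st z, J s st -> J s (upd st (arr 0) (Posz state) z)) ->
  globals st -> J 0%N st ->
  wp (for_states c) (fun st' => globals st' /\ J K st') st.
Proof.
move=> hc hJ g J0; apply: wp_seq; apply: wp_set => //.
pose I k st' := exists s, [/\ (k + s = K)%N, globals st',
  st' (arr 0) (Posz state) = Posz s & J s st'].
apply: (wp_while (I := I) (k := K)).
- move=> k st' [s [ks g' hs Js]] /=; have [_ _ _ ->] := g'.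
  rewrite hs -PoszD lez_nat addn1 => sK; exists k.-1; first lia.
  apply: wp_seq; apply: wp_conseq (hc _ _ sK g' hs Js).
  move=> st1 [g1 hs1 Js1]; apply: wp_set; rewrite /= hs1 -PoszD addn1.
    by apply: small_le; lia.
  exists s.+1; split; [lia|exact: globals_set| |exact: hJ].
  by rewrite /upd !eqxx.
- move=> k st' [s [ks g' hs Js]] /=; have [_ _ _ ->] := g'.
  rewrite hs -PoszD ltz_nat addn1 ltnS => Ks.
  by have -> : K = s by lia.
- lia.
- exists 0%N; split; rewrite ?addn0//; [exact: globals_set| |exact: hJ].
  by rewrite /upd !eqxx.
Qed.

Lemma wp_init_value st s : (s < K)%N -> globals st ->
  st (arr 0) (Posz state) = Posz s -> filled 0 s st ->
  wp init_value (fun st' => [/\ globals st',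
    st' (arr 0) (Posz state) = Posz s & filled 0 s.+1 st']) st.
Proof.
move=> sK g hs f; have [_ _ hQ _] := g.
have post z : z = Posz (accepts s) ->
    wp (Set_ vals (var state) (Cst z)) (fun st' => [/\ globals st',
      st' (arr 0) (Posz state) = Posz s & filled 0 s.+1 st']) st.
  move=> ->; apply: wp_set => /=; first by case: accepts; rewrite ?expn_gt0.
  rewrite hs; split; first by apply: globals_upd => //; rewrite arr_eq.
    by rewrite /upd arr_eq.
  apply: filled_next => //; first exact: (@filled_upd_cell 0).
  by rewrite /upd !eqxx.
rewrite /init_value; move: post; rewrite /accepts.
elim: (iota 0 d) => [|i t IH] /= post; first exact: post.
have e1 : aeval st (Bin Mul (Cst (th i)) topE) = th i * Posz r.
  by rewrite aeval_bin aeval_top.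
have e2 : aeval st (Bin Mul (Cst (Posz b)) (testE i M)) =
    Posz b * \sum_(k < M) coef k * (digit r (i * M + k) s)%:Z.
  by rewrite aeval_bin (aeval_test _ _ hQ hs).
apply: wp_if; rewrite e1 e2 => h.
  by apply: IH => z hz; apply: post; rewrite h.
by apply: post; rewrite leNgt h.
Qed.

Definition at_cell (l s : nat) (st : store) : Prop :=
  [/\ globals st, st (arr 0) (Posz state) = Posz s,
      st (arr 0) (Posz item) = Posz l, answered l st & filled l.+1 s st].

Lemma at_cell_upd l s st x z : x \in [:: 1; 2; 3]%N -> (s < K)%N ->
  at_cell l s st -> at_cell l s (upd st (arr x) (Posz (l.+1 * K + s)) z).
Proof.
move=> x13 sK [g hs hl ha f].
have x0 : (arr x != arr 0) by rewrite arr_eq; case: (x) x13.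
split; first exact: globals_upd.
- by rewrite /upd eq_sym (negbTE x0).
- by rewrite /upd eq_sym (negbTE x0).
- by move=> k kM; rewrite /upd arr_eq; move: x13; rewrite !inE;
    case: (x) => [|[|[|[|?]]]] //= _; exact: ha.
- exact: filled_upd_cell.
Qed.

Lemma value_small l s : (l <= n)%N -> (value l s <= 2 ^ B)%N.
Proof.
move=> ln; apply: leq_trans (value_le _ _ _ _ _ _ _ _) _.
apply: leq_trans Bv; rewrite ltnS -(big_mkord xpredT v) -(big_mkord xpredT v).
by rewrite (big_cat_nat _ ln)//= leq_addr.
Qed.

Lemma wp_layer st l s : (s < K)%N -> (l < n)%N -> at_cell l s st ->
  wp layerC (fun st' => [/\ globals st', st' (arr 0) (Posz state) = Posz s &
    [/\ st' (arr 0) (Posz item) = Posz l, answered l st' &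
     filled l.+1 s.+1 st']]) st.
Proof.
move=> sK ln c0.
have newP st' : at_cell l s st' -> aeval st' newE = Posz (l.+1 * K + s).
  by move=> [g hs hl _ _]; apply: aeval_cell => //=; rewrite hl -PoszD addn1.
have oldP st' e s' : at_cell l s st' -> (s' < K)%N -> aeval st' e = Posz s' ->
    aeval st' (Get vals (cellE (var item) e)) = Posz (value l s').
  move=> [g hs hl _ f] s'K he.
  rewrite aeval_get (aeval_cell (l := l) (s := s'))//.
  by have [] := f l s' s'K; rewrite ?ltnSn.
(* The fold of [layer] stopped after [i] knapsacks; between the unrolled steps the three cells of
   the new row hold it. *)
pose acc i := foldl (improve d M r a v (value l) l s) (value l s, 0%N, s) (iota 0 i).
pose J i st' := [/\ at_cell l s st',
  st' vals (Posz (l.+1 * K + s)) = Posz (acc i).1.1,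
  st' choices (Posz (l.+1 * K + s)) = Posz (acc i).1.2 &
  st' nexts (Posz (l.+1 * K + s)) = Posz (acc i).2].
apply: wp_seq; apply: wp_set.
  by rewrite (oldP _ _ s)//; [exact/value_small/ltnW|have [] := c0].
rewrite newP// (oldP _ _ s)//; last by have [] := c0.
set st1 := upd _ _ _ _; have c1 : at_cell l s st1 by exact: at_cell_upd.
apply: wp_seq; apply: wp_set => //; rewrite newP//.
set st2 := upd _ _ _ _; have c2 : at_cell l s st2 by exact: at_cell_upd.
have s2 : aeval st2 (var state) = Posz s by have [] := c2.
apply: wp_seq; apply: wp_set; first by rewrite s2; apply: small_le; lia.
rewrite newP// s2; set st3 := upd _ _ _ _.
have c3 : at_cell l s st3 by exact: at_cell_upd.
apply: (wp_conseq (Q := J d)).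
  move=> st' [[g hs hl ha f] h1 h2 h3]; split=> //; split=> //.
  exact: filled_next.
apply: wp_sequence; last first.
  by split=> //; rewrite /st3 /st2 /st1 /upd !arr_eq !eqxx/=.
move=> i st' id [c h1 h2 h3].
have accS : acc i.+1 = improve d M r a v (value l) l s (acc i) i.
  by rewrite /acc -addn1 iotaD foldl_cat.
have insP st0 : at_cell l s st0 -> aeval st0 (insertE i) = Posz (insert l i s).
  by move=> [[_ _ hQ _] hs hl ha f]; exact: aeval_insert.
have iK := insert_lt d M ar l i s.
set s' := insert l i s in insP iK.
have oldI := oldP _ _ _ c iK (insP _ c).
have newI : aeval st' (Bin Add (Get vals (cellE (var item) (insertE i)))
    (Get 1 (var item))) = Posz (value l s' + v l).
  rewrite aeval_bin oldI; have [[[_ hv] _ _ _] _ hl _ _] := c.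
  by rewrite /= hl hv// PoszD.
apply: wp_if; rewrite [aeval _ (Cst _)]/= oldI => h.
  have h2' : aeval st' (Bin Add (Get vals newE) (Cst (Posz 1))) = Posz (acc i).1.1.+1.
    by rewrite aeval_bin aeval_get newP// h1 /= -PoszD addn1.
  apply: wp_if; rewrite h2' newI => lt.
    have accE : acc i.+1 = ((value l s' + v l)%N, i.+1, s').
      rewrite accS /improve -/s'; have -> : (0 < value l s')%N by move: h; lia.
      by have -> : ((acc i).1.1 < value l s' + v l)%N by move: lt; lia.
    apply: wp_seq; apply: wp_set.
      (* The number stored is one of the candidates for [value l.+1 s], which is bounded by the
         total profit plus one. *)
      rewrite newI; apply: leq_trans (value_small s ln).
      have /= := layer_ge (M := M) (r := r) (a := a) v (V := value l) (l := l) (s := s) id; rewrite -/s' mul1n.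
      by apply; move: h; lia.
    rewrite newI newP//; set st4 := upd _ _ _ _.
    have c4 : at_cell l s st4 by exact: at_cell_upd.
    apply: wp_seq; apply: wp_set; first by rewrite /=; apply: small_le; lia.
    rewrite newP//; set st5 := upd _ _ _ _.
    have c5 : at_cell l s st5 by exact: at_cell_upd.
    apply: wp_set; first by rewrite insP//=; apply: small_le; lia.
    rewrite newP// insP//; set st6 := upd _ _ _ _.
    split; first exact: at_cell_upd.
    + by rewrite accE /st6 /st5 /st4 /upd !arr_eq !eqxx.
    + by rewrite accE /st6 /st5 /st4 /upd !arr_eq !eqxx.
    + by rewrite accE /st6 /st5 /st4 /upd !arr_eq !eqxx.
  apply: wp_skip; split=> //; rewrite accS /improve -/s';
    have -> : ((acc i).1.1 < value l s' + v l)%N = false by move: lt; lia.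
  - by rewrite andbF.
  - by rewrite andbF.
  - by rewrite andbF.
by apply: wp_skip; split=> //; rewrite accS /improve -/s';
  have -> : (0 < value l s')%N = false by move: h; lia.
Qed.

Lemma wp_ask st l : (l < n)%N -> globals st ->
  st (arr 0) (Posz item) = Posz l -> filled l.+1 0 st ->
  wp (sequence ask M) (fun st' => [/\ globals st',
    st' (arr 0) (Posz item) = Posz l, answered l st' & filled l.+1 0 st']) st.
Proof.
move=> ln g hl f.
pose J k st' := [/\ globals st', st' (arr 0) (Posz item) = Posz l,
  filled l.+1 0 st' &
  forall k', (k' < k)%N -> st' (answers k') 0 = (a l k')%:Z - 1].
apply: (wp_conseq (Q := J M)); first by move=> st' [].
apply: wp_sequence => // k st' kM [g' hl' f' h].
have [_ hm _ _] := g'; have [h1 h2] := orcP ln kM.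
apply: wp_query; rewrite /= ?hl' ?hm //=; first lia.
  have pB : (2 ^ nbits * 2 ^ 2 <= 2 ^ B)%N by rewrite -expnD leq_exp2l//; lia.
  by rewrite h1; have := ar l k; have := expn_gt0 2 nbits; rewrite /top; lia.
have ak x : (arr x == answers k) = (x == k.+4) by exact: arr_eq.
split.
- by do 2 (apply: globals_upd => //; first by rewrite eq_sym ak).
- by rewrite /upd !ak.
- by do 2 (apply: filled_upd; first by rewrite !inE ![answers k == _]eq_sym !ak).
- move=> k'; rewrite ltnS leq_eqVlt /upd !ak !eqSS !eqxx andbF/= andbT.
  by case: eqP => [-> _|_ /= k'k]; [exact: h1|exact: h].
Qed.

Lemma wp_fill_tables st : globals st -> filled 0 K st ->
  wp fill_tables (fun st' => [/\ globals st',
    st' (arr 0) (Posz item) = Posz n & filled n.+1 0 st']) st.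
Proof.
move=> g f; apply: wp_seq; apply: wp_set => //.
pose I k st' := exists l, [/\ (k + l = n)%N, globals st',
  st' (arr 0) (Posz item) = Posz l & filled l.+1 0 st'].
apply: (wp_while (I := I) (k := n)).
- move=> k st' [l [kl g' hl fl]] /=; have [[-> _] _ _ _] := g'.
  rewrite hl -PoszD lez_nat addn1 => ln; exists k.-1; first lia.
  apply: wp_seq; apply: wp_conseq (wp_ask ln g' hl fl).
  move=> st1 [g1 hl1 a1 f1]; apply: wp_seq.
  pose J s st' := [/\ st' (arr 0) (Posz item) = Posz l, answered l st' &
    filled l.+1 s st'].
  apply: (wp_conseq (Q := fun st' => globals st' /\ J K st')); last first.
    apply: wp_for_states => //.
    + by move=> s st2 sK g2 hs [hl2 a2 f2]; apply: wp_layer.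
    + move=> s st2 z [hl2 a2 f2]; split.
      * by rewrite /upd !eqxx.
      * by move=> c cM; rewrite /upd arr_eq; exact: a2.
      * by apply: filled_upd => //; rewrite !inE !arr_eq.
  move=> st2 [g2 [hl2 a2 f2]]; apply: wp_set.
    by rewrite /= hl2; apply: small_le; lia.
  exists l.+1; split; [lia|exact: globals_set| |].
    by rewrite /upd /= hl2 !eqxx/= -PoszD addn1.
  by apply: filled_upd; [rewrite !inE !arr_eq|exact: filled_layer].
- move=> k st' [l [kl g' hl fl]] /=; have [[-> _] _ _ _] := g'.
  rewrite hl -PoszD ltz_nat addn1 ltnS => nl.
  by have <- : l = n by lia.
- lia.
- exists 0%N; split; rewrite ?addn0//; [exact: globals_set|by rewrite /upd !eqxx|].
  by apply: filled_upd; [rewrite !inE !arr_eq|exact: filled_layer].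
Qed.

Lemma wp_trace st : globals st -> st (arr 0) (Posz item) = Posz n ->
  filled n.+1 0 st ->
  wp trace (fun st' => forall i j, (i < d)%N -> (j < n)%N ->
    (st' i.+2 (Posz j) == 1) = (greedy n K.-1 j == i.+1)) st.
Proof.
move=> g hn f; have K0 : (0 < K)%N by rewrite expn_gt0.
have [_ _ _ hK] := g.
have out_arr x i : (i < d)%N -> (i.+2 == arr x) = false.
  by move=> id; rewrite eq_sym arr_out.
apply: wp_seq; apply: wp_set; rewrite /= hK; first by apply: small_le; lia.
pose out l (st' : store) := forall i j, (i < d)%N -> (l <= j < n)%N ->
  (st' i.+2 (Posz j) == 1) = (greedy n K.-1 j == i.+1).
(* Items from [l] on are already decoded, and below [l] the solution is the greedy one from the
   current state. *)
pose I l st' := exists s, [/\ (l <= n)%N && (s < K)%N,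
  [/\ globals st', st' (arr 0) (Posz state) = Posz s,
      st' (arr 0) (Posz item) = Posz l & filled n.+1 0 st'],
  forall j, (j < l)%N -> greedy n K.-1 j = greedy l s j & out l st'].
apply: (wp_while (I := I) (k := n)); last 2 first.
- lia.
- exists K.-1; split=> //; [lia| |by move=> i j _; lia].
  split; [exact: globals_set|by rewrite /upd !eqxx/=; lia|by rewrite /upd !eqxx|].
  by apply: filled_upd; [rewrite !inE !arr_eq|].
- move=> [|l] st' [s [/andP[ln sK] [g' hs hl fl] hg ho]] /=; rewrite hl // => _.
  exists l => //; apply: wp_seq; apply: wp_set; rewrite /= hl.
    by apply: small_le; lia.
  rewrite (_ : Posz l.+1 - 1 = Posz l); last lia.
  set st1 := upd _ _ _ _.
  have ch : greedy n K.-1 l = choice_at l s by rewrite hg//= eqxx.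
  pose J k st' := [/\ [/\ globals st', st' (arr 0) (Posz state) = Posz s,
      st' (arr 0) (Posz item) = Posz l & filled n.+1 0 st'], out l.+1 st' &
    forall i, (i < k)%N ->
      (st' i.+2 (Posz l) == 1) = (greedy n K.-1 l == i.+1)].
  have newP st2 : globals st2 -> st2 (arr 0) (Posz state) = Posz s ->
      st2 (arr 0) (Posz item) = Posz l -> aeval st2 newE = Posz (l.+1 * K + s).
    by move=> g2 hs2 hl2; apply: aeval_cell => //=; rewrite hl2 -PoszD addn1.
  apply: wp_seq; apply: (wp_conseq (Q := J d)); last first.
    apply: wp_sequence; last first.
      split=> //; last first.
        by move=> i j id jn; rewrite /st1 /upd out_arr//; exact: ho.
      split; [exact: globals_set|by rewrite /st1 /upd !eqxx|
        by rewrite /st1 /upd !eqxx|].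
      by apply: filled_upd; [rewrite !inE !arr_eq|].
    move=> i st2 id [[g2 hs2 hl2 f2] ho2 hi].
    have val2 : aeval st2 (Bin Defs.Sub (Get choices newE) (Cst (Posz i))) =
        Posz (choice_at l s) - Posz i.
      rewrite aeval_bin aeval_get newP//.
      by have [|_ /(_ isT)[-> _]] := f2 l.+1 s sK; first by rewrite ltnS ln.
    apply: wp_set; rewrite val2.
      by apply: small_le; have := choice_at_le d M r a v accepts l s; lia.
    rewrite /= hl2; split; [split| |].
    + by apply: globals_upd; rewrite ?out_arr.
    + by rewrite /upd arr_out.
    + by rewrite /upd arr_out.
    + by apply: filled_upd; rewrite // !inE !out_arr.
    + move=> i' j id' lj; rewrite /upd eqz_nat (gtn_eqF (_ : l < j)%N) ?andbF; last lia.
      exact: ho2.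
    + move=> i'; rewrite ltnS leq_eqVlt /upd !eqSS eqxx andbT ch.
      case: eqP => [-> _|_ /= i'i]; first by apply/eqP/eqP; lia.
      by rewrite hi// ch.
  move=> st2 [[g2 hs2 hl2 f2] ho2 hd].
  have val2 : aeval st2 (Get nexts newE) = Posz (next_state l s).
    rewrite aeval_get newP//.
    by have [|_ /(_ isT)[_ ->]] := f2 l.+1 s sK; first by rewrite ltnS ln.
  have nK := next_state_lt v accepts ar l sK.
  apply: wp_set; rewrite val2; first by apply: small_le; lia.
  exists (next_state l s); split; first by rewrite (ltnW ln).
  + split; [exact: globals_set|by rewrite /upd !eqxx|by rewrite /upd !eqxx|].
    by apply: filled_upd; [rewrite !inE !arr_eq|].
  + by move=> j jl; rewrite hg ?ltnS 1?ltnW//= ltn_eqF.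
  + move=> i j id /andP[]; rewrite leq_eqVlt /upd out_arr//= => /predU1P[<- _|lj jn].
      exact: hd.
    by apply: ho2 => //; rewrite lj.
- move=> l st' [s [_ [g' hs hl fl] _ ho]] /=; rewrite hl => l0.
  by move=> i j id jn; apply: ho => //; move: l0; lia.
Qed.

Lemma wp_knapsack st : inputs st -> st (arr 0) (Posz prec) = 0 ->
  wp knapsack (fun st' => forall i j, (i < d)%N -> (j < n)%N ->
    (st' i.+2 (Posz j) == 1) = (greedy n K.-1 j == i.+1)) st.
Proof.
move=> h0 h1; apply: wp_seq; apply: wp_conseq (wp_choose_scale h0 h1).
move=> st1 [i1 m1 q1]; apply: wp_seq; apply: wp_set; rewrite aeval_pow//.
  by apply: small_le; lia.
rewrite /=; set st2 := upd _ _ _ _.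
have g2 : globals st2.
  by split; [exact: inputs_upd|by rewrite /st2 /upd !eqxx..].
apply: wp_seq; apply: (wp_conseq (Q := fun st' => globals st' /\ filled 0 K st')).
  move=> st3 [g3 f3]; apply: wp_seq.
  apply: wp_conseq (wp_fill_tables g3 f3) => st4 [g4 n4 f4].
  exact: wp_trace.
apply: wp_for_states => //.
- by move=> s st3 sK g3 hs3 f3; exact: wp_init_value.
- by move=> s st3 z f3; apply: filled_upd; rewrite ?inE ?arr_eq.
- by move=> l' s' _; lia.
Qed.

End Correctness.
End Program.

(** * From the oracle to the chance constraints *)

Section OracleAnswers.
Context {disp : measure_display} {T : measurableType disp} {R : realType}.
Variables (P : probability T R) (n : nat) (w : 'I_n -> {RV P >-> R}).
Variables (q : nat) (orc : oracle).
Hypothesis q1 : (0 < q)%N.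
Hypothesis orc_w : computes_expectations w orc.

(** The principal argument of a positive real is acos 1 = 0. *)
Lemma cpow_real (a x : R) : 0 < a -> cpow (a +i* 0)%C x = ((a `^ x) +i* 0)%C.
Proof.
move=> a0; rewrite /cpow /principal_arg.
have -> : complex.Re `|(a +i* 0)%C| = a.
  by rewrite normc_def /= expr0n addr0 sqrtr_sqr gtr0_norm.
by rewrite /= lexx divff ?gt_eqF// acos1 mulr0 cos0 sin0 mulr1 mulr0.
Qed.

(** Each component of a complex error is at most its modulus. The mean is real, so the second answer
    is small; this matters because the query stores it too. *)
Lemma oracle_moment (j : 'I_n) (k m : nat) :
  let ans := orc (nat_of_ord j)%:Z 1 0 (Posz (q ^ k)) m%:Z in
  `|ans.1%:~R - 2 ^+ m * moment w q k j| <= 1 /\ (`|ans.2| <= 1)%N.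
Proof.
move=> ans; have qk0 : (0 < q ^ k)%N by rewrite expn_gt0 q1.
have u0 : 0 < (q%:R^-1 : R) ^+ k by rewrite exprn_gt0// invr_gt0 ltr0n.
have phiE : (1%:~R / (Posz (q ^ k))%:~R : R) = q%:R^-1 ^+ k.
  by rewrite div1r exprVn -pmulrn natrX.
have := @orc_w j 1 0 (Posz (q ^ k)) m.
rewrite -/ans phiE mul0r => /(_ _ _)/wrap[]//.
  rewrite normc_def /= expr0n addr0 sqrtr_sqr gtr0_norm// lecR.
  by rewrite exprn_ile1// ?invr_ge0// invf_le1 ?ltr0n// ler1n.
set z := cexpectation _ _; have -> : z = (moment w q k j +i* 0)%C.
  rewrite /z /cexpectation; congr (_ +i* _)%C.
    by rewrite expectationE; congr mean; apply/funext => t; rewrite cpow_real.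
  rewrite expectationE -[RHS](mean_cst P); congr mean.
  by apply/funext => t; rewrite cpow_real.
rewrite normc_def lecR/= oppr0 addr0 => h.
have p0 : 0 < 2 ^+ m :> R by rewrite exprn_gt0.
have hx : `|ans.1%:~R / 2 ^+ m - moment w q k j| <= 2 ^- m.
  by apply: le_trans h; rewrite -sqrtr_sqr ler_wsqrtr// lerDl sqr_ge0.
have hy : `|ans.2%:~R / 2 ^+ m : R| <= 2 ^- m.
  by apply: le_trans h; rewrite -sqrtr_sqr ler_wsqrtr// lerDr sqr_ge0.
split.
  rewrite (_ : _ - _ = (ans.1%:~R / 2 ^+ m - moment w q k j) * 2 ^+ m).
    by rewrite normrM (gtr0_norm p0) -ler_pdivlMr// mul1r.
  by rewrite mulrBl divfK ?gt_eqF// [moment _ _ _ _ * _]mulrC.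
move: hy; rewrite normrM normfV (gtr0_norm p0) ler_pdivrMr// mulVf ?gt_eqF//.
by rewrite -intr_norm -[1]/(1%:~R) ler_int; lia.
Qed.

End OracleAnswers.

(** * Choice of the constants [b] and [q] *)

Lemma nat_ge_real (R : realType) (x : R) : exists2 k : nat, (0 < k)%N & x <= k%:R.
Proof. by exists (Num.truncn x).+1 => //; exact/ltW/truncnS_gt. Qed.

(** Summing the individual bounds gives one [b] for all indices. It is applied to multiples of
    [gamma i], and no [b] could serve an index with [gamma i = 0]. *)
Lemma exists_uniform_slack (R : realType) (d : nat) (x : 'I_d -> R) :
  exists2 b : nat, (0 < b)%N & forall i, 0 < x i -> b%:R^-1 <= x i.
Proof.
pose f i := (Num.truncn (x i)^-1).+1.
exists (\sum_i f i).+1%N => // i xi.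
rewrite -[leRHS]invrK lef_pV2 ?posrE ?invr_gt0 ?ltr0n//.
apply: (@le_trans _ _ (f i)%:R); first exact/ltW/truncnS_gt.
by rewrite ler_nat (bigD1 i)//= -addnS leq_addr.
Qed.

Lemma exists_base (R : realType) (eps y : R) : 0 < eps -> 0 < y ->
  exists2 q : nat, (0 < q)%N & (q%:R^-1 : R) `^ eps <= y.
Proof.
move=> e0 y0; have [q q0 hq] := nat_ge_real (y^-1 `^ eps^-1).
have qR : 0 < q%:R :> R by rewrite ltr0n.
exists q => //; have -> : (q%:R^-1 : R) `^ eps = (q%:R `^ eps)^-1.
  by rewrite -(@powR_inv1 _ q%:R) ?ltW// -powRrM mulN1r powRN.
rewrite -[leRHS]invrK lef_pV2 ?posrE ?invr_gt0 ?powR_gt0//.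
have := @ge0_ler_powR _ eps (ltW e0) _ _ _ _ hq.
rewrite !nnegrE powR_ge0 ltW// => /(_ isT isT).
by rewrite -powRrM mulVf ?gt_eqF// powRr1// invr_ge0 ltW.
Qed.

Definition extend (A : Type) (n : nat) (x0 : A) (f : 'I_n -> A) (j : nat) : A :=
  if insub j is Some i then f i else x0.

Lemma extendE (A : Type) n (x0 : A) (f : 'I_n -> A) (j : 'I_n) : extend x0 f j = f j.
Proof. by rewrite /extend valK. Qed.

(** * Disjoint families of sets as choice functions *)

Section Assignments.
Variables (d n : nat).

Definition bins (ch : nat -> nat) (i : 'I_d) : {set 'I_n} :=
  [set j : 'I_n | ch j == i.+1].

Lemma bins_disjoint ch : pairwise_disjoint (bins ch).
Proof.
apply/forallP => i; apply/forallP => j; apply/implyP => ij.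
rewrite -setI_eq0; apply/eqP/setP => k; rewrite !inE.
apply/negbTE/negP => /andP[/eqP-> /eqP[e]].
by move/eqP: ij; apply; apply/val_inj.
Qed.

Lemma gain_bins (v : 'I_n -> nat) ch : (forall j, ch j <= d)%N ->
  gain (extend 0%N v) n ch = total_profit v (bins ch).
Proof.
move=> chd; rewrite /gain /total_profit /profit.
under [RHS]eq_bigr do rewrite big_mkcond.
rewrite exchange_big; apply: eq_bigr => j _.
rewrite extendE; under [RHS]eq_bigr do rewrite inE.
case: (posnP (ch j)) => [->|ch0].
  by rewrite big1.
have cd : ((ch j).-1 < d)%N by have := chd j; lia.
rewrite mul1n (bigD1 (Ordinal cd))//= prednK// eqxx big1 ?addn0// => i ij.
case: eqP => // e; case/eqP: ij; apply/val_inj => /=; rewrite e.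
by [].
Qed.

Lemma bins_of_disjoint (S : 'I_d -> {set 'I_n}) : pairwise_disjoint S ->
  exists2 ch, (forall j, ch j <= d)%N & forall i, bins ch i = S i.
Proof.
move=> dS; pose f (j : 'I_n) := if [pick i | j \in S i] is Some i then i.+1 else 0%N.
exists (extend 0%N f) => [j|i].
  by rewrite /extend; case: insubP => // j' _ _; rewrite /f; case: pickP.
apply/setP => j; rewrite inE extendE /f; case: pickP => [i' ji'|/(_ i) ->//].
apply/eqP/idP => [[e]|ji]; first by rewrite (_ : i = i')//; exact/val_inj.
have [->//|ii] := eqVneq i' i.
have /forallP/(_ i')/forallP/(_ i) := dS; rewrite ii/= => /pred0P/(_ j).
by rewrite /= ji' ji.
Qed.

End Assignments.

(** Profits may be exponential in the input size, but the table entries have no more bits than the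
    profits together, up to a constant. *)
Lemma sum_lt_exp2_bitlen n (v : 'I_n -> nat) :
  (\sum_(j < n) v j < 2 ^ (\sum_(j < n) bitlen (v j)%:Z))%N.
Proof.
elim/big_rec2: _ => // j x y _ h; rewrite expnD.
have : (v j < 2 ^ bitlen (v j)%:Z)%N by apply: trunc_log_ltn.
nia.
Qed.

Lemma size_le_input n (v : 'I_n -> nat) : (n <= input_size v)%N.
Proof.
rewrite /input_size; apply: leq_trans (leq_addl _ _).
rewrite -[n in (n <= _)%N]card_ord -sum1_card; exact: leq_sum.
Qed.

(** * Accepted states and the chance constraints *)

Section Acceptance.
Context {disp : measure_display} {T : measurableType disp} {R : realType}.
Variables (P : probability T R) (n : nat) (w : 'I_n -> {RV P >-> R}).
Variables (d q b : nat) (orc : oracle).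
Hypothesis w_ge0 : forall j t, 0 <= w j t.
Hypothesis w_indep : mutually_independent w.
Hypothesis orc_w : computes_expectations w orc.
Hypotheses (q1 : (0 < q)%N) (b0 : (0 < b)%N).

Local Notation M := (b * q)%N.
Local Notation C := (3 * 2 ^ M * b)%N.
Local Notation m := (nbits C n).
Local Notation r := (top C n).
Local Notation K := (r.+1 ^ (d * M))%N.

(* Capped so that it is at most [r] on meaningless queries too. *)
Definition rounded (l k : nat) : nat :=
  minn r (absz ((orc l%:Z 1 0 (Posz (q ^ k.+1)) m%:Z).1 + 1)).

Lemma rounded_le l k : (rounded l k <= r)%N.
Proof. exact: geq_minl. Qed.

Lemma rounded_moment (j : 'I_n) k :
  let ans := orc (nat_of_ord j)%:Z 1 0 (Posz (q ^ k.+1)) m%:Z in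
  [/\ ans.1 = (rounded j k)%:Z - 1, (`|ans.2| <= 1)%N &
      `|(rounded j k)%:R - r%:R * moment w q k.+1 j| <= 2].
Proof.
move=> ans; have [h1 h2] := oracle_moment q1 orc_w j k.+1 m.
rewrite -/ans in h1 h2; have /andP[e0 e1] := moment01 w_ge0 q1 k.+1 j.
set e := moment _ _ _ _ in h1 e0 e1 *.
have p0 : 0 < 2 ^+ m :> R by rewrite exprn_gt0.
have rE : (Posz r)%:~R = 2 ^+ m + 2 :> R.
  by rewrite /top -pmulrn -addn2 natrD natrX.
move: h1; rewrite ler_norml => /andP[l1 l2].
have pe : 2 ^+ m * e <= 2 ^+ m by rewrite ler_piMr// ltW.
have pe0 : 0 <= 2 ^+ m * e by rewrite mulr_ge0// ltW.
have a1 : 0 <= ans.1 + 1 by rewrite -(ler_int R) rmorphD/=; lra.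
have a2 : ans.1 + 1 <= Posz r by rewrite -(ler_int R) rmorphD/= rE; lra.
have aE : Posz (rounded j k) = ans.1 + 1.
  by rewrite /rounded -/ans (minn_idPr _) ?gez0_abs// -lez_nat gez0_abs.
split=> //; first by rewrite aE; lia.
rewrite [X in `|X - _|]pmulrn aE rmorphD/= pmulrn rE mulrDl ler_norml.
by apply/andP; split; lra.
Qed.

(** The expansion of the mean of the soft step for knapsack [i], computed from rounded products and
    scaled by [r]. *)
Definition score (s i : nat) : int :=
  \sum_(k < M) soft_coef M k * (digit r (i * M + k) s)%:Z.

(** An error of 3 n per digit, weighted by coefficients of absolute sum at most 2^M and multiplied
    by [b], is [C n <= r]; this is the origin of [C]. *)
Lemma score_mean ch (i : 'I_d) (S : {set 'I_n}) : bins n ch i = S ->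
  `|b%:R * (score (run d M r rounded n ch K.-1) i)%:~R
    - b%:R * r%:R * mean P (fun t => soft M (q%:R^-1 `^ total_size w S t))| <= r%:R.
Proof.
move=> bS; rewrite -mulrA -mulrBr normrM normr_nat mean_soft// mulr_sumr.
rewrite rmorph_sum/= -sumrB.
have M0 : (0 < M)%N by rewrite muln_gt0 b0.
have r0 : (0 < r)%N by [].
have dig (k : 'I_M) : `|(digit r (i * M + k) (run d M r rounded n ch K.-1))%:R
    - r%:R * \prod_(j in S) moment w q k.+1 j| <= 3 * n%:R.
  have cD : (i * M + k < d * M)%N by have := ltn_ord i; have := ltn_ord k; nia.
  have := @digit_run_error d M r rounded rounded_le R
    (fun l k => extend 0 (moment w q k.+1) l) n ch K.-1 _ r0 cD.
  (* All digits of the initial state are [r], which represents the empty product 1. *)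
  rewrite digit_max// divnMDl// divn_small// addn0 modnMDl modn_small//.
  rewrite (eq_bigr (fun j => moment w q k.+1 j)); last by move=> j _; rewrite extendE.
  rewrite (eq_bigl (fun j => j \in S) (moment w q k.+1)); last first.
    by move=> j; rewrite -bS inE.
  apply=> l k' ln _; rewrite (extendE 0 _ (Ordinal ln)).
  by split; [exact: moment01|have [] := rounded_moment (Ordinal ln) k'].
apply: (@le_trans _ _ (b%:R * ((2 ^ M)%:R * (3 * n%:R)))).
  apply: ler_wpM2l => //; apply: le_trans (ler_norm_sum _ _ _) _.
  apply: le_trans (_ : \sum_(k < M) `|(soft_coef M k)%:~R : R| * (3 * n%:R) <= _).
    apply: ler_sum => k _; rewrite rmorphM/= mulrCA -mulrBr normrM.
    by apply: ler_wpM2l => //; exact: dig.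
  by rewrite -mulr_suml; apply: ler_wpM2r; [rewrite mulr_ge0|exact: soft_coef_sum].
have : (C * n <= r)%N.
  have := up_logP (C * n).+1 (ltnSn 1); rewrite -/(nbits C n) /top; lia.
by rewrite -(ler_nat R) !natrM; lra.
Qed.

Variables (gamma : 'I_d -> R) (eps : R).
Hypothesis gamma_ge0 : forall i, 0 <= gamma i.
Hypothesis eps_gt0 : 0 < eps.
Hypothesis base_small : (q%:R^-1 : R) `^ eps <= (b%:R ^+ 2)^-1.
Hypothesis b_large : forall i, 0 < eps * gamma i / 5 -> b%:R^-1 <= eps * gamma i / 5.

(* The threshold [th i / b] lies between [gamma i - 3 / b] and [gamma i - 2 / b],
   and the computed score is within [1 / b] of the mean of the soft step. *)
Definition threshold : nat -> int :=
  extend (0 : int) (fun i : 'I_d => Num.floor (b%:R * gamma i) - 2).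

Local Notation accepts := (accepts d M b C (soft_coef M) threshold n).

Lemma acceptsP s :
  reflect (forall i : 'I_d, (threshold i)%:~R * r%:R <= b%:R * (score s i)%:~R :> R)
    (accepts s).
Proof.
apply: (iffP allP) => [h i|h i].
  have := h i; rewrite mem_iota/= ltn_ord => /(_ isT).
  by rewrite -(ler_int R) !rmorphM.
rewrite mem_iota /= add0n => id; have := h (Ordinal id).
by rewrite -(ler_int R) !rmorphM.
Qed.

(** In units of 1/b, the soft step loses 1 and the computation another 1: hence the shift by 2 in
    [threshold]. *)
Lemma feasible_accepts ch : (forall i, fits w 1 (gamma i) (bins n ch i)) ->
  accepts (run d M r rounded n ch K.-1).
Proof.
move=> hf; apply/acceptsP => i.
have := score_mean (erefl (bins n ch i)); rewrite ler_norml => /andP[h _].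
have := fits_mean_soft w_ge0 q1 b0 (hf i).
set mu := mean _ _ in h *; set sc := (score _ _)%:~R in h *.
rewrite /threshold extendE intrD => hmu.
have fl : (Num.floor (b%:R * gamma i))%:~R <= b%:R * gamma i by exact: floor_le.
have bR : 0 < b%:R :> R by rewrite ltr0n.
have rR : 0 < r%:R :> R by rewrite ltr0n.
have {}hmu : b%:R * gamma i - 1 <= b%:R * mu.
  have := ler_wpM2l (ltW bR) hmu; rewrite mulrBr mulfV ?gt_eqF//.
have h1 : (b%:R * gamma i - 1) * r%:R <= b%:R * mu * r%:R by rewrite ler_pM2r.
have h2 : (Num.floor (b%:R * gamma i))%:~R * r%:R <= b%:R * gamma i * r%:R.
  by rewrite ler_pM2r.
move: h h1 h2; clearbody mu sc; set F := (Num.floor _)%:~R; clearbody F.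
rewrite rmorphN /=; nra.
Qed.

(** In units of 1/b, the integer part loses 1, the shift 2 and the computation 1, so the mean is at
    least gamma_i - 4/b. The soft step costs one more unit, and 5/b <= eps gamma_i. *)
Lemma accepted_fits ch : accepts (run d M r rounded n ch K.-1) ->
  forall i, fits w (1 + eps) ((1 - eps) * gamma i) (bins n ch i).
Proof.
move=> /acceptsP hacc i; have := hacc i; rewrite /threshold extendE intrD => {hacc}.
have := score_mean (erefl (bins n ch i)); rewrite ler_norml => /andP[_].
have [->|g0] := eqVneq (gamma i) 0; first by move=> _ _; rewrite /fits mulr0.
have bg := @b_large i; move: bg; have gi : 0 < gamma i by rewrite lt_neqAle eq_sym g0 gamma_ge0.
rewrite divr_gt0 ?mulr_gt0// => /(_ isT) bg h hacc.
apply: (mean_soft_fits w_ge0 q1 b0 eps_gt0 base_small).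
set mu := mean _ _ in h *; set sc := (score _ _)%:~R in h hacc *.
have fl : b%:R * gamma i < (Num.floor (b%:R * gamma i))%:~R + 1.
  by rewrite -(intrD _ _ 1); exact: floorD1_gt.
have bR : 0 < b%:R :> R by rewrite ltr0n.
have rR : 0 < r%:R :> R by rewrite ltr0n.
have h2 : (b%:R * gamma i - 1) * r%:R <= (Num.floor (b%:R * gamma i))%:~R * r%:R.
  by rewrite ler_pM2r//; lra.
have h3 : (b%:R * gamma i - 4) * r%:R <= b%:R * mu * r%:R.
  move: h hacc h2; clearbody mu sc; set F := (Num.floor _)%:~R; clearbody F.
  by rewrite rmorphN /=; nra.
rewrite ler_pM2r// in h3.
have {}h3 : gamma i - 4 * b%:R^-1 <= mu.
  rewrite -(ler_pM2l bR) mulrBr mulrCA mulfV ?gt_eqF// mulr1; lra.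
lra.
Qed.

End Acceptance.

(** * Polynomial bounds and the conclusion *)

Lemma scale_le C n x : (n <= x)%N -> (2 ^ nbits C n <= 2 * C * x + 2)%N.
Proof.
move=> nx; rewrite /nbits.
case: (posnP (C * n)%N) => [->|Cn]; first by rewrite up_log1; lia.
have := @up_log_gtn 2 (C * n).+1 (ltnSn 1) Cn.
rewrite ltnS; have : (0 < up_log 2 (C * n).+1)%N by rewrite up_log_gt0.
by case: (up_log _ _) => // l _ /=; rewrite expnS; nia.
Qed.

Lemma bounded_input B n (v : 'I_n -> nat) : (n <= 2 ^ B)%N ->
  (\sum_(j < n) v j < 2 ^ B)%N -> bounded B (input v).
Proof.
move=> nB vB [|[|x]] [[|k]|k] //=; case: insubP => // j _ _ /=;
  by apply: leq_trans (ltnW vB); rewrite (bigD1 j)//= leq_addr.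
Qed.

(* Any number bounds the bit length of a smaller one, so the bound on the
   numbers stored can be taken as large as that on the number of iterations. *)
Lemma knapsack_polynomial d M q b C coef th : exists p : {poly nat},
  forall n (v : 'I_n -> nat), exists B N : nat,
  [/\ (ctime B.+1 N (knapsack d M q b C coef th) <= p.[input_size v])%N,
      (d + (top C n).+1 ^ (d * M) + n + C * n + nbits C n + 2 <= B)%N,
      (n + (top C n).+1 ^ (d * M) + nbits C n <= N)%N &
      (\sum_(j < n) v j < 2 ^ B)%N].
Proof.
(* The exponent [d * M] is a constant of the program, so the number of states is polynomial in the
   input size. *)
pose pK : {poly nat} := ((2 * C)%N%:P * 'X + 5%N%:P) ^+ (d * M).
pose pN : {poly nat} := 'X + pK + (2 * C)%N%:P * 'X + 2%N%:P.
pose pB : {poly nat} := pN + 'X + C%:P * 'X + d%:P + 3%N%:P.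
have [p hp] := ctime_poly pB pN (knapsack d M q b C coef th).
exists p => n v; have nx := size_le_input v.
have bx : (\sum_(j < n) bitlen (v j)%:Z <= input_size v)%N by exact: leq_addl.
move: (input_size v) nx bx => x nx bx.
have sx := scale_le C nx.
pose xK := ((2 * C * x + 5) ^ (d * M))%N.
have KxK : ((top C n).+1 ^ (d * M) <= xK)%N.
  have le : ((top C n).+1 <= 2 * C * x + 5)%N by rewrite /top; lia.
  by rewrite /xK; elim: (d * M)%N => // e IH; rewrite !expnS leq_mul.
have NE : pN.[x] = (x + xK + 2 * C * x + 2)%N by rewrite /pN /pK !hornerE.
have BE : pB.[x] = (x + xK + 2 * C * x + 2 + x + C * x + d + 3)%N.
  by rewrite /pB /pN /pK !hornerE.
have nb : (nbits C n < 2 ^ nbits C n)%N by exact: ltn_expl.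
have Cnx : (C * n <= C * x)%N by rewrite leq_mul2l nx orbT.
set yN := pN.[x] in NE; set yB := pB.[x] in BE.
have BS : yB.-1.+1 = yB by rewrite prednK// BE addn3 addnS.
exists yB.-1, yN; rewrite BS hp; split=> //; try lia.
apply: leq_trans (sum_lt_exp2_bitlen v) _; rewrite leq_exp2l//; lia.
Qed.

Theorem theorem8 (R : realType) (d : nat) (eps : R) (gamma : 'I_d -> R)
    (heps : 0 < eps) (hgamma : forall i : 'I_d, 0 <= gamma i <= 1) :
  exists (prog : com) (p : {poly nat}),
    forall (n : nat) (disp : measure_display) (T : measurableType disp)
           (P : probability T R) (w : 'I_n -> {RV P >-> R})
           (v : 'I_n -> nat) (orc : oracle),
      (forall (j : 'I_n) (t : T), 0 <= w j t) ->
      mutually_independent w ->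
      computes_expectations w orc ->
      exists (s : store) (time : nat),
        exec orc prog (input v) s time /\
        (time <= p.[input_size v])%N /\
        let S : 'I_d -> {set 'I_n} := output d n s in
        pairwise_disjoint S /\
        (1 - eps) * (opt w v gamma)%:R <= (total_profit v S)%:R :> R /\
        (forall i : 'I_d, fits w (1 + eps) ((1 - eps) * gamma i) (S i)).
Proof.
have [b b0 hb] := exists_uniform_slack (fun i => eps * gamma i / 5).
have b2 : 0 < (b%:R ^+ 2)^-1 :> R by rewrite invr_gt0 exprn_gt0// ltr0n.
have [q q1 hq] := exists_base heps b2.
pose M := (b * q)%N; pose C := (3 * 2 ^ M * b)%N; pose th := threshold b gamma.
have [p hp] := knapsack_polynomial d M q b C (soft_coef M) th.
exists (knapsack d M q b C (soft_coef M) th), p.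
move=> n disp T P w v orc w_ge0 w_indep orc_w.
have [B [N [tp BK NK vB]]] := hp n v.
have g0 i : 0 <= gamma i by have /andP[] := hgamma i.
pose r := top C n; pose s0 := (r.+1 ^ (d * M)).-1.
pose a := rounded n q b orc; pose vv := extend 0%N v.
pose acc := accepts d M b C (soft_coef M) th n.
pose ch := greedy d M r a vv acc n s0.
have feas := feasible_accepts w_ge0 w_indep orc_w q1 b0.
have good := accepted_fits w_ge0 w_indep orc_w q1 b0 g0 heps hq hb.
have orcP l k : (l < n)%N -> (k < M)%N ->
    let ans := orc l%:Z 1 0 (Posz (q ^ k.+1)) (nbits C n)%:Z in
    ans.1 = (a l k)%:Z - 1 /\ (`|ans.2| <= 2 ^ B)%N.
  move=> ln _; have [h1 h2 _] := rounded_moment w_ge0 orc_w q1 b0 (Ordinal ln) k.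
  by split=> //; apply: leq_trans h2 _; rewrite expn_gt0.
have vvB : (\sum_(j < n) vv j < 2 ^ B)%N.
  by under eq_bigr do rewrite /vv extendE.
have inp : inputs n vv (input v).
  split=> // j jn; rewrite /= /vv /extend; by case: insubP.
have nB : (n <= 2 ^ B)%N by apply: leq_trans (ltnW (ltn_expl B (ltnSn 1))); lia.
have [s [t [ex tle _ post]]] := wp_knapsack b (soft_coef M) th
  (rounded_le n q b orc) orcP BK vvB NK inp erefl (bounded_input nB vB).
have outE i : output d n s i = bins n ch i.
  by apply/setP => j; rewrite !inE post.
have gE c : (forall j, c j <= d)%N -> gain vv n c = total_profit v (bins (d := d) n c).
  exact: gain_bins.
have ch_le j : (ch j <= d)%N by exact: greedy_le.
have valued S : pairwise_disjoint S -> (forall i, fits w 1 (gamma i) (S i)) ->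
    (total_profit v S < value d M r a vv acc n s0)%N.
  move=> dS fS; have [c cd cS] := bins_of_disjoint dS.
  have -> : total_profit v S = gain vv n c.
    by rewrite gE//; apply: eq_bigr => i _; rewrite cS.
  by apply: value_ge => //; apply: feas => i; rewrite cS.
(* Empty knapsacks are feasible since [gamma i <= 1]; hence the initial state has an accepted
   continuation, as [greedyP] requires. *)
have pos : (0 < value d M r a vv acc n s0)%N.
  apply: leq_trans (valued (fun=> finset.set0) _ _) => //.
    by apply/forallP => i; apply/forallP => j; rewrite -setI_eq0 finset.set0I eqxx implybT.
  move=> i; rewrite /fits.
  rewrite (_ : [set t | _]%classic = setT); last first.
    by apply/seteqP; split=> // x _ /=; rewrite /total_size big_set0 ler01.
  by have /andP[_ g1] := hgamma i; rewrite (probability_setT P) lee_fin.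
have [accd valE] := greedyP pos.
exists s, t; split=> //; split; first exact: leq_trans tle tp.
have SE : output d n s = bins n ch by apply/funext.
rewrite SE /=; split; first exact: bins_disjoint.
split; last by move=> i; exact: good.
have le : (opt w v gamma <= total_profit v (bins (d := d) n ch))%N.
  apply/bigmax_leqP => S /andP[dS /forallP fS].
  by have := valued _ dS fS; rewrite valE ltnS gE.
apply: (@le_trans _ _ (opt w v gamma)%:R); last by rewrite ler_nat.
by rewrite ler_piMl//; lra.
Qed.
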